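(* Suppose hypothesis (H) stated in the context holds. Let $g$ be analytic for $\bar a<x<\bar b$, with $g(0)=0$, $g'(0)=1$ and $g''(0)\ne0$, and let $G(x)=\int_0^xg(\xi)\,d\xi$ be the potential of $\ddot x+g(x)=0$. 1. Suppose that, for $\bar a<x<\bar b$, $$g(x)^2+\frac{g''(0)}3\,g(x)^3-2G(x)g'(x)>0\quad(\text{respectively }<0).$$ Then the period function of $\ddot x+g(x)=0$ satisfies $T'(c)>0$ (respectively $T'(c)<0$) for $0<c<\bar c$. 2. Suppose $$\frac{d}{dx}\left[\frac{G(x)}{g(x)^2}\right]=\alpha,\qquad \alpha=-\frac{g''(0)}3\neq0 .$$ Then $0$ is an isochronous center of $\ddot x+g(x)=0$. Moreover, the so-called Urabe potential $$G(x)=\frac4{\alpha^2}-\frac2\alpha\left(x+2\,\frac{\sqrt{1-\alpha x}}{\alpha}\right),\qquad |x|<1/\alpha,$$ is the unique analytic solution of this equation satisfying $g(0)=G(0)=0$ and $G''(0)=1$ (where $g=G'$).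
   Context: Hypothesis (H): there exist $a<0<b$ such that $G(a)=G(b)=c$, and $G(x)<c$ and $x\,g(x)>0$ for all $a<x<b$, $x\neq0$. Under these conditions the system $\dot x=y$, $\dot y=-g(x)$ has a periodic orbit of energy $c$ with turning points $a,b$, where $\bar a<a<0<b<\bar b$ for some $\bar a,\bar b$, and the origin is a center. The minimal period of this orbit is $T(c)=\sqrt2\int_a^b\frac{dx}{\sqrt{c-G(x)}}$; it is defined and analytic for $0<c<\bar c$, where, when $\bar c<+\infty$, $\bar c$ is the energy of the homoclinic orbit, with turning points $\bar a<0<\bar b$. The center $0$ is called isochronous if all periodic orbits near $(0,0)$ have the same minimal period.
   Formalization: As printed, the Urabe potential satisfies (G/g²)' = -α/2, not α; so α in its formula and in |x|<1/α is replaced by β = -2α (domain |x|<1/|β|), the equation being unchanged. The strict inequality and the equation are required only for x≠0, since at 0 they read 0>0 and 0/0. *)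

(* Defs.v *)
From Stdlib Require Export Reals ClassicalEpsilon.
From Coquelicot Require Export Coquelicot.

Set Implicit Arguments.
Open Scope R_scope.

(* Open intervals ]lo, hi[ with possibly infinite ends. *)
Definition between (lo hi : Rbar) (x : R) : Prop :=
  Rbar_lt lo x /\ Rbar_lt x hi.

Definition analytic_at (f : R -> R) (x0 : R) : Prop :=
  exists a : nat -> R,
    Rbar_lt 0 (CV_radius a) /\ locally x0 (fun x => f x = PSeries a (x - x0)).

Definition analytic_on (f : R -> R) (lo hi : Rbar) : Prop :=
  forall x, between lo hi x -> analytic_at f x.

Definition potential (g : R -> R) (x : R) : R := RInt g 0 x.

(* g is only meaningful on ]lo, hi[, so solutions are required to stay there. *)
Definition is_solution (g : R -> R) (lo hi : Rbar) (x y : R -> R) : Prop :=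
  forall t, between lo hi (x t) /\ is_derive x t (y t) /\ is_derive y t (- g (x t)).

Definition is_period (x y : R -> R) (T : R) : Prop :=
  0 < T /\ forall t, x (t + T) = x t /\ y (t + T) = y t.

(* A constant solution has no minimal period in this sense. *)
Definition minimal_period (x y : R -> R) (T : R) : Prop :=
  is_period x y T /\ forall S, is_period x y S -> T <= S.

(* Such a and b are determined by c. *)
Definition turning_points (g : R -> R) (lo hi : Rbar) (c a b : R) : Prop :=
  between lo hi a /\ between lo hi b /\ a < 0 < b /\
  potential g a = c /\ potential g b = c /\
  forall x, a < x < b -> x <> 0 -> potential g x < c /\ 0 < x * g x.

Definition hypothesis_H (g : R -> R) (lo hi : Rbar) (c : R) : Prop :=
  exists a b, turning_points g lo hi c a b.

(* Upper end of the range of energies of the period annulus of the origin;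
   the energies c satisfying hypothesis_H form an interval with lower end 0. When the
   annulus is bounded by a homoclinic orbit with turning points lo and hi,
   this is the energy of that orbit. *)
Definition energy_bound (g : R -> R) (lo hi : Rbar) : Rbar :=
  Lub_Rbar (hypothesis_H g lo hi).

(* T is the minimal period of the orbit of energy c around the origin.
   Confinement to [a, b] excludes other components of the level set
   y^2/2 + G(x) = c. *)
Definition is_period_of_energy (g : R -> R) (lo hi : Rbar) (c T : R) : Prop :=
  exists (a b : R) (x y : R -> R),
    turning_points g lo hi c a b /\ is_solution g lo hi x y /\
    (forall t, a <= x t <= b /\ y t ^ 2 / 2 + potential g (x t) = c) /\
    minimal_period x y T.

Definition period_function (g : R -> R) (lo hi : Rbar) (c : R) : R :=
  epsilon (inhabits 0) (is_period_of_energy g lo hi c).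

Definition is_center (g : R -> R) (lo hi : Rbar) : Prop :=
  g 0 = 0 /\
  exists eps, 0 < eps /\
    forall x0 y0, 0 < x0 ^ 2 + y0 ^ 2 < eps ^ 2 ->
      exists (x y : R -> R) (T : R),
        is_solution g lo hi x y /\ x 0 = x0 /\ y 0 = y0 /\ minimal_period x y T.

Definition isochronous_center (g : R -> R) (lo hi : Rbar) : Prop :=
  is_center g lo hi /\
  exists eps T0, 0 < eps /\
    forall (x y : R -> R) (T : R),
      is_solution g lo hi x y -> x 0 ^ 2 + y 0 ^ 2 < eps ^ 2 ->
      minimal_period x y T -> T = T0.

(* (P / p^2)' = alpha with p = P', away from 0, where P / p^2 is 0 / 0. *)
Definition potential_equation (alpha : R) (P : R -> R) (lo hi : Rbar) : Prop :=
  forall x, between lo hi x -> x <> 0 ->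
    is_derive (fun z => P z / Derive P z ^ 2) x alpha.

Definition normalized_solution (alpha : R) (P : R -> R) (lo hi : Rbar) : Prop :=
  analytic_on P lo hi /\ P 0 = 0 /\ Derive P 0 = 0 /\ Derive_n P 2 0 = 1 /\
  potential_equation alpha P lo hi.

(* Away from 0, urabe beta / (urabe beta)'^2 = (1 - beta x) / 2, so that
   urabe beta solves the equation above with alpha = - beta / 2. *)
Definition urabe (beta x : R) : R :=
  4 / beta ^ 2 - 2 / beta * (x + 2 * (sqrt (1 - beta * x) / beta)).

(* Main.v *)
Require Import Defs.
From Stdlib Require Import Lra Lia Ranalysis5 Classical.

(** Write [h x = sgn x * sqrt (2 G x)], a smooth coordinate near the well, with inverse [phi].
    Since [g (phi u) * phi' u = u], the system becomes [u' = y / phi' u], [y' = - u / phi' u]: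
    with [u = r sin th] and [y = r cos th], orbits are circles [r = sqrt (2 c)] run through at
    angular speed [1 / phi' (r sin th)]. Hence [T] is the integral of [phi' (r sin th)] over a
    turn, and [dT/dr] that of [phi'' (r sin th) sin th]. As [sin] has mean zero, its sign is
    that of [(phi'' u - k) u] for any constant [k]. Now
    [phi'' = (g^2 - 2 G g') / g^3] is also [(G / g^2)']; taking [k = - g''(0) / 3] gives the
    monotonicity criterion, and if [phi''] is constant then [phi'] is affine and [T] does not
    depend on [r].

    For the Urabe equation, [P / P'^2 = 1/2 + alpha x] by continuity at [0], so that
    [h' = 1 / sqrt (1 + 2 alpha x)], which determines [h] and [P = h^2 / 2]. *)

Set Implicit Arguments.
Unset Strict Implicit.

(** * Calculus and analytic functions *)

(** The integral of [1 / sqrt (c - G)] resists direct differentiation: its limits move with [c] and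
    its integrand is singular there. In angle form the limits are fixed and the integrand is C1 in
    [r], so the derivative passes under the integral.

    The obstacle is then the origin, where [h] involves the square root of a vanishing function and
    [h / g] and [G / g^2] are 0 / 0. Writing [G = x^2 B] and [g = x A], with [B 0 = 1 / 2] and
    [A 0 = 1], gives [h = x sqrt (2 B)] and [phi' = sqrt (2 B) / A], both regular across 0.

    The turning points are a second difficulty: [g] may vanish there, as on a homoclinic orbit. An
    orbit of energy [c] is therefore studied inside a well of some larger energy [c0], so that
    [|u| <= sqrt (2 c)] stays strictly inside the range of the coordinate.

    The constant [k = - g''(0) / 3] is [phi''(0)]: it cancels the cubic Taylor term of
    [g^2 - k g^3 - 2 G g'], and any other [k] would make that expression change sign at 0. *)

Lemma between_locally (lo hi : Rbar) (x : R) :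
  between lo hi x -> locally x (between lo hi).
Proof.
intros [H1 H2]. apply filter_and.
- exact (open_Rbar_gt lo x H1).
- exact (open_Rbar_lt hi x H2).
Qed.

Lemma between_convex (lo hi : Rbar) (x y z : R) :
  between lo hi x -> between lo hi y -> x <= z <= y -> between lo hi z.
Proof.
intros [H1 _] [_ H2] [H3 H4]. split.
- apply Rbar_lt_le_trans with x; [exact H1 | exact H3].
- apply Rbar_le_lt_trans with y; [exact H4 | exact H2].
Qed.

Lemma is_derive_cont (f : R -> R) (x l : R) : is_derive f x l -> continuous f x.
Proof. intros H. apply (ex_derive_continuous (V := R_NormedModule)). now exists l. Qed.

Lemma ex_derive_cont (f : R -> R) (x : R) : ex_derive f x -> continuous f x.
Proof. exact (ex_derive_continuous (V := R_NormedModule) f x). Qed.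

Lemma is_derive_eq (f : R -> R) (x l l' : R) : is_derive f x l -> l = l' -> is_derive f x l'.
Proof. now intros H <-. Qed.

Lemma mean_value (f df : R -> R) (x y : R) :
  (forall t, Rmin x y <= t <= Rmax x y -> is_derive f t (df t)) ->
  exists t, Rmin x y <= t <= Rmax x y /\ f y - f x = df t * (y - x).
Proof.
intros H. apply MVT_gen.
- intros t Ht. apply H. lra.
- intros t Ht. apply continuity_pt_filterlim, (is_derive_cont (l := df t)). now apply H.
Qed.

(** The derivative is required strictly inside only, so that one end can be the origin: there some
    functions below are known to be continuous while the formula for their derivative is 0 / 0. *)
Lemma zero_derive_const (f : R -> R) (x y : R) :
  (forall t, Rmin x y < t < Rmax x y -> is_derive f t 0) ->
  (forall t, Rmin x y <= t <= Rmax x y -> continuous f t) ->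
  f x = f y.
Proof.
intros H Hc. destruct (MVT_gen f x y (fun _ => 0)) as [t [_ E]]; [exact H | | lra].
intros t Ht. now apply continuity_pt_filterlim, Hc.
Qed.

Lemma derive_pos_lt (f df : R -> R) (x y : R) :
  (forall t, x <= t <= y -> is_derive f t (df t)) -> (forall t, x <= t <= y -> 0 < df t) ->
  x < y -> f x < f y.
Proof.
intros H Hp Hxy.
destruct (@mean_value f df x y) as [t [Ht E]].
- rewrite Rmin_left, Rmax_right by lra. exact H.
- rewrite Rmin_left, Rmax_right in Ht by lra. specialize (Hp t Ht). nra.
Qed.

Lemma locally_ball (x0 : R) (P : R -> Prop) :
  locally x0 P -> exists d, 0 < d /\ forall x, Rabs (x - x0) < d -> P x.
Proof. intros [d H]. exists d. split; [apply cond_pos | exact H]. Qed.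

Lemma ball_locally (x0 d : R) (P : R -> Prop) :
  0 < d -> (forall x, Rabs (x - x0) < d -> P x) -> locally x0 P.
Proof. intros Hd H. exists (mkposreal d Hd). exact H. Qed.

Lemma locally_neq (x0 z : R) : x0 <> z -> locally x0 (fun x => x <> z).
Proof.
intros H. apply (@ball_locally x0 (Rabs (x0 - z))).
- apply Rabs_pos_lt. lra.
- intros x Hx E. subst. rewrite Rabs_minus_sym in Hx. lra.
Qed.

Lemma CV_radius_ball (a : nat -> R) :
  Rbar_lt 0 (CV_radius a) ->
  exists d, 0 < d /\ forall y, Rabs y < d -> Rbar_lt (Rabs y) (CV_radius a).
Proof.
intros H. destruct (CV_radius a) as [r | |].
- exists r. split; [exact H | intros y Hy; exact Hy].
- exists 1. split; [lra | now intros].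
- destruct H.
Qed.

Lemma analytic_at_unfold (f : R -> R) (x0 : R) :
  analytic_at f x0 ->
  exists (a : nat -> R) (d : R), 0 < d /\ Rbar_lt 0 (CV_radius a) /\
    forall x, Rabs (x - x0) < d ->
      f x = PSeries a (x - x0) /\ Rbar_lt (Rabs (x - x0)) (CV_radius a).
Proof.
intros [a [Ha Hl]]. destruct (CV_radius_ball Ha) as [d1 [Hd1 H1]].
destruct (locally_ball Hl) as [d2 [Hd2 H2]].
exists a, (Rmin d1 d2). split; [now apply Rmin_pos |]. split; [exact Ha |].
intros x Hx. pose proof (Rmin_l d1 d2). pose proof (Rmin_r d1 d2).
split; [apply H2 | apply H1]; lra.
Qed.

Lemma locally_of_ball (x0 d x : R) (P : R -> Prop) :
  Rabs (x - x0) < d -> (forall z, Rabs (z - x0) < d -> P z) -> locally x P.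
Proof.
intros Hx H. apply (@ball_locally x (d - Rabs (x - x0))); [lra |].
intros z Hz. apply H. replace (z - x0) with ((z - x) + (x - x0)) by ring.
pose proof (Rabs_triang (z - x) (x - x0)). lra.
Qed.

Lemma is_derive_PSeries_shift (a : nat -> R) (x0 x : R) :
  Rbar_lt (Rabs (x - x0)) (CV_radius a) ->
  is_derive (fun z => PSeries a (z - x0)) x (PSeries (PS_derive a) (x - x0)).
Proof.
intros H.
apply is_derive_eq with (scal 1 (PSeries (PS_derive a) (x - x0))).
- apply (is_derive_comp (PSeries a) (fun z => z - x0)).
  + now apply is_derive_PSeries.
  + auto_derive; [easy | ring].
- unfold scal; simpl; unfold mult; simpl. ring.
Qed.

Lemma analytic_at_derive (f : R -> R) (x0 : R) :
  analytic_at f x0 -> locally x0 (ex_derive f) /\ analytic_at (Derive f) x0.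
Proof.
intros Hf. destruct (analytic_at_unfold Hf) as [a [d [Hd [Ha H]]]].
assert (D : forall x, Rabs (x - x0) < d -> is_derive f x (PSeries (PS_derive a) (x - x0))).
{ intros x Hx. apply is_derive_ext_loc with (fun z => PSeries a (z - x0)).
  - apply (@locally_of_ball x0 d x); [exact Hx |]. intros z Hz. symmetry. now apply H.
  - apply is_derive_PSeries_shift. now apply H. }
split.
- apply (@ball_locally x0 d); [exact Hd |]. intros x Hx. eexists. now apply D.
- exists (PS_derive a). split; [now rewrite CV_radius_derive |].
  apply (@ball_locally x0 d); [exact Hd |]. intros x Hx. now apply is_derive_unique, D.
Qed.

Lemma analytic_at_ext_loc (f h : R -> R) (x0 : R) :
  locally x0 (fun x => f x = h x) -> analytic_at f x0 -> analytic_at h x0.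
Proof.
intros E [a [Ha H]]. exists a. split; [exact Ha |].
refine (filter_imp _ _ _ (filter_and _ _ E H)).
now intros x [<- ->].
Qed.

(** Supplies the analyticity of the potential, which is given as an integral of [g]. The difference
    between [F] and the termwise primitive of the series of its derivative has zero derivative and
    vanishes at [x0]. *)
Lemma analytic_at_primitive (F : R -> R) (x0 : R) :
  locally x0 (ex_derive F) -> analytic_at (Derive F) x0 -> analytic_at F x0.
Proof.
intros HF Hf. destruct (analytic_at_unfold Hf) as [a [d [Hd [Ha H]]]].
destruct (locally_ball HF) as [e [He HF']].
set (b := fun n => match n with O => F x0 | S m => a m / INR (S m) end).
assert (Eb : forall n, PS_derive b n = a n).
{ intros n. unfold PS_derive, b. field. apply not_0_INR. lia. }
assert (Cb : CV_radius b = CV_radius a).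
{ rewrite <- CV_radius_derive. now apply CV_radius_ext. }
exists b. split; [now rewrite Cb |].
apply (@ball_locally x0 (Rmin d e)); [now apply Rmin_pos |]. intros x Hx.
pose proof (Rmin_l d e). pose proof (Rmin_r d e).
assert (D : forall t, Rmin x0 x <= t <= Rmax x0 x ->
  is_derive (fun z => F z - PSeries b (z - x0)) t 0).
{ intros t Ht.
  assert (Rabs (t - x0) < Rmin d e).
  { apply Rle_lt_trans with (2 := Hx). revert Ht. unfold Rmin, Rmax.
    destruct (Rle_dec x0 x); unfold Rabs; destruct (Rcase_abs _); destruct (Rcase_abs _); lra. }
  apply is_derive_eq with (Derive F t - PSeries (PS_derive b) (t - x0)).
  - apply (is_derive_minus (V := R_NormedModule) F (fun z => PSeries b (z - x0))).
    + apply Derive_correct, HF'. lra.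
    + apply is_derive_PSeries_shift. rewrite Cb. apply H. lra.
  - rewrite (PSeries_ext _ a _ Eb). rewrite (proj1 (H t ltac:(lra))). ring. }
assert (E := @zero_derive_const (fun z => F z - PSeries b (z - x0)) x0 x
  (fun t Ht => D t ltac:(lra)) (fun t Ht => is_derive_cont (D t Ht))).
simpl in E. rewrite Rminus_diag, PSeries_0 in E. simpl in E. lra.
Qed.

(* The value at [0] makes it continuous there when [f 0 = 0]. *)
Definition divx (f : R -> R) (x : R) : R :=
  match Req_EM_T x 0 with left _ => Derive f 0 | right _ => f x / x end.

Lemma divx_0 (f : R -> R) : divx f 0 = Derive f 0.
Proof. unfold divx. now destruct (Req_EM_T 0 0). Qed.

Lemma divx_neq0 (f : R -> R) (x : R) : x <> 0 -> divx f x = f x / x.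
Proof. unfold divx. now destruct (Req_EM_T x 0). Qed.

Lemma mul_divx (f : R -> R) (x : R) : f 0 = 0 -> x * divx f x = f x.
Proof.
intros H. destruct (Req_dec x 0) as [-> | Hx].
- rewrite H. ring.
- rewrite divx_neq0 by easy. now field.
Qed.

Lemma analytic_at_Derive_n (f : R -> R) (a : nat -> R) (n : nat) :
  Rbar_lt 0 (CV_radius a) -> locally 0 (fun x => f x = PSeries a x) ->
  Derive_n f n 0 = a n * INR (Factorial.fact n).
Proof.
intros Ha H. rewrite <- Derive_n_coef by exact Ha. now apply Derive_n_ext_loc.
Qed.

(** Dividing by [x] shifts the Taylor coefficients down by one, so the singularity is removable and
    the new linear coefficient is the old quadratic one. *)
Lemma divx_series (f : R -> R) :
  f 0 = 0 -> analytic_at f 0 ->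
  analytic_at (divx f) 0 /\ Derive (divx f) 0 = Derive_n f 2 0 / 2.
Proof.
intros H0 Hf. destruct (analytic_at_unfold Hf) as [a [d [Hd [Ha H]]]].
assert (Hl : locally 0 (fun x => f x = PSeries a x)).
{ apply (@ball_locally 0 d); [exact Hd |]. intros x Hx.
  rewrite (proj1 (H x Hx)). now rewrite Rminus_0_r. }
assert (Hl' : locally 0 (fun x => divx f x = PSeries (PS_decr_1 a) x)).
{ apply (@ball_locally 0 d); [exact Hd |]. intros x Hx.
  destruct (H x Hx) as [H1 H2]. rewrite Rminus_0_r in H1, H2.
  assert (Hx0 : a 0%nat = 0).
  { rewrite <- PSeries_0. rewrite <- (locally_singleton _ _ Hl). exact H0. }
  destruct (Req_dec x 0) as [-> | Hx1].
  - rewrite divx_0, PSeries_0.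
    change (Derive f 0) with (Derive_n f 1 0). rewrite (@analytic_at_Derive_n f a 1 Ha Hl).
    unfold PS_decr_1. simpl. ring.
  - rewrite divx_neq0 by easy. rewrite H1, PSeries_decr_1, Hx0.
    + now field.
    + apply CV_radius_inside. exact H2. }
assert (Ha' : Rbar_lt 0 (CV_radius (PS_decr_1 a))) by now rewrite CV_radius_decr_1.
split.
- exists (PS_decr_1 a). split; [exact Ha' |].
  refine (filter_imp _ _ _ Hl'). intros x E. now rewrite Rminus_0_r.
- change (Derive (divx f) 0) with (Derive_n (divx f) 1 0).
  rewrite (@analytic_at_Derive_n (divx f) (PS_decr_1 a) 1 Ha' Hl'), (@analytic_at_Derive_n f a 2 Ha Hl).
  unfold PS_decr_1. simpl. field.
Qed.

(** Stands in for analyticity once the divisions by [x] are done: it passes through quotients and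
    square roots by elementary calculus, and [phi'] being C1 is all that differentiating the period
    asks for. *)
Definition C1_at (f : R -> R) (x : R) : Prop :=
  locally x (ex_derive f) /\ continuous (Derive f) x.

Lemma C1_at_is_derive (f : R -> R) (x : R) : C1_at f x -> is_derive f x (Derive f x).
Proof. intros [H _]. apply Derive_correct. exact (locally_singleton _ _ H). Qed.

Lemma C1_at_cont (f : R -> R) (x : R) : C1_at f x -> continuous f x.
Proof. intros H. exact (is_derive_cont (C1_at_is_derive H)). Qed.

Lemma C1_at_ext_loc (f h : R -> R) (x : R) :
  locally x (fun z => f z = h z) -> C1_at f x -> C1_at h x.
Proof.
intros E [H1 H2]. apply locally_locally in E. split.
- refine (filter_imp _ _ _ (filter_and _ _ E H1)).
intros z [Ez Hz].
  exact (ex_derive_ext_loc _ _ _ Ez Hz).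
- refine (continuous_ext_loc _ _ _ _ H2). refine (filter_imp _ _ _ E).
  intros z Ez. now apply Derive_ext_loc.
Qed.

Lemma C1_at_of_is_derive (f df : R -> R) (x : R) :
  locally x (fun z => is_derive f z (df z)) -> continuous df x -> C1_at f x.
Proof.
intros H Hc. split.
- refine (filter_imp _ _ _ H). intros z Hz. now exists (df z).
- refine (continuous_ext_loc _ _ _ _ Hc). refine (filter_imp _ _ _ H).
  intros z Hz. symmetry. now apply is_derive_unique.
Qed.

Lemma analytic_at_C1 (f : R -> R) (x : R) : analytic_at f x -> C1_at f x.
Proof.
intros H. destruct (analytic_at_derive H) as [H1 H2]. split; [exact H1 |].
apply ex_derive_cont.
exact (locally_singleton _ _ (proj1 (analytic_at_derive H2))).
Qed.

Lemma C1_at_div (f k : R -> R) (x : R) :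
  C1_at f x -> C1_at k x -> k x <> 0 -> C1_at (fun z => f z / k z) x.
Proof.
intros Hf Hk Hx.
assert (Hl : locally x (fun z => k z <> 0)).
{ exact (C1_at_cont Hk (locally_neq Hx)). }
apply C1_at_of_is_derive with
  (fun z => (Derive f z * k z - f z * Derive k z) / k z ^ 2).
- destruct Hf as [Hf _]. destruct Hk as [Hk _].
  refine (filter_imp _ _ _ (filter_and _ _ Hl (filter_and _ _ Hf Hk))).
  intros z [H1 [H2 H3]]. apply is_derive_div; [now apply Derive_correct.. | exact H1].
- apply continuity_pt_filterlim.
  assert (Cf := proj2 (continuity_pt_filterlim _ _) (C1_at_cont Hf)).
  assert (Ck := proj2 (continuity_pt_filterlim _ _) (C1_at_cont Hk)).
  assert (Cf' := proj2 (continuity_pt_filterlim _ _) (proj2 Hf)).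
  assert (Ck' := proj2 (continuity_pt_filterlim _ _) (proj2 Hk)).
  apply (continuity_pt_ext (fun z => (Derive f z * k z - f z * Derive k z) / (k z * k z))).
  { intros z. simpl. now rewrite Rmult_1_r. }
  reg. now apply Rmult_integral_contrapositive.
Qed.

Lemma C1_at_divx (f : R -> R) (x : R) :
  f 0 = 0 -> C1_at f x -> analytic_at f 0 -> C1_at (divx f) x.
Proof.
intros H0 Hx Hf. destruct (Req_dec x 0) as [-> | Hx0].
- now apply analytic_at_C1, divx_series.
- apply C1_at_ext_loc with (fun z => f z / z).
  + refine (filter_imp _ _ _ (locally_neq Hx0)).
intros z Hz. now rewrite divx_neq0.
  + apply C1_at_div; [exact Hx | | exact Hx0].
    apply C1_at_of_is_derive with (fun _ => 1).
    * apply filter_forall. intros z. exact (is_derive_id (K := R_AbsRing) z).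
    * apply continuous_const.
Qed.

(** The image of [f] is an interval whose ends are not known and may be infinite. Bracketing [u]
    between two attained values replaces any description of that image and leaves room on both sides
    of [u]. *)
Lemma inverse_function (lo hi : Rbar) (f df : R -> R) :
  (forall x, between lo hi x -> is_derive f x (df x) /\ 0 < df x) ->
  exists psi : R -> R,
    (forall x, between lo hi x -> psi (f x) = x) /\
    forall x1 x2 u, between lo hi x1 -> between lo hi x2 -> f x1 < u < f x2 ->
      x1 < psi u < x2 /\ f (psi u) = u /\ is_derive psi u (/ df (psi u)).
Proof.
intros H.
assert (Inc : forall x y, between lo hi x -> between lo hi y -> x < y -> f x < f y).
{ intros x y Hx Hy Hxy.
  apply derive_pos_lt with df; [| | exact Hxy];
    intros t Ht; apply H; exact (between_convex Hx Hy Ht). }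
assert (Refl : forall x y, between lo hi x -> between lo hi y -> f x < f y -> x < y).
{ intros x y Hx Hy Hxy. destruct (Rtotal_order x y) as [E | [E | E]]; [exact E | subst; lra |].
  specialize (Inc y x Hy Hx E). lra. }
set (psi := fun u => epsilon (inhabits 0) (fun x => between lo hi x /\ f x = u)).
assert (Spec : forall u, (exists x, between lo hi x /\ f x = u) ->
  between lo hi (psi u) /\ f (psi u) = u).
{ intros u Hu. exact (epsilon_spec (inhabits 0) _ Hu). }
assert (Val : forall x1 x2 u, between lo hi x1 -> between lo hi x2 -> f x1 < u < f x2 ->
  x1 < psi u < x2 /\ f (psi u) = u).
{ intros x1 x2 u H1 H2 [Hu1 Hu2].
  assert (H12 : x1 < x2) by (apply Refl; try assumption; lra).
  destruct (IVT_interv (fun z => f z - u) x1 x2) as [z [Hz Ez]]; try lra.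
  { intros t Ht. apply continuity_pt_filterlim.
    apply (is_derive_cont (f := fun z => f z - u) (l := df t - 0)).
    apply (is_derive_minus (V := R_NormedModule) f (fun _ => u)).
    - apply H. exact (between_convex H1 H2 Ht).
    - exact (is_derive_const u t). }
  destruct (Spec u) as [S1 S2].
  { exists z. split; [exact (between_convex H1 H2 Hz) | lra]. }
  split; [split; apply Refl; try assumption; lra | exact S2]. }
exists psi. split.
- intros x Hx. destruct (Spec (f x)) as [S1 S2]; [now exists x |].
  destruct (Rtotal_order (psi (f x)) x) as [E | [E | E]]; [| exact E |];
    apply Inc in E; try assumption; lra.
- intros x1 x2 u H1 H2 Hu. destruct (Val x1 x2 u H1 H2 Hu) as [V1 V2].
  split; [exact V1 |]. split; [exact V2 |].
  assert (Bu : between lo hi (psi u)).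
  { apply (between_convex H1 H2). lra. }
  destruct (H _ Bu) as [D1 D2].
  (* Monotonicity squeezes [psi]: [y1] and [y2] lie within [e] of [psi u], on either side and still
     in [[x1, x2]]. The values strictly between [f y1] and [f y2] form a neighbourhood of [u] that
     [psi] sends between [y1] and [y2]. *)
  assert (Cu : continuity_pt psi u).
  { apply continuity_pt_filterlim. intros Q [e He].
    set (y1 := Rmax x1 (psi u - e / 2)). set (y2 := Rmin x2 (psi u + e / 2)).
    pose proof (cond_pos e) as Pe.
    assert (Y1 : x1 <= y1 < psi u /\ psi u - e < y1).
    { unfold y1, Rmax. destruct (Rle_dec _ _); lra. }
    assert (Y2 : psi u < y2 <= x2 /\ y2 < psi u + e).
    { unfold y2, Rmin. destruct (Rle_dec _ _); lra. }
    assert (B1 : between lo hi y1) by (apply (between_convex H1 H2); lra).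
    assert (B2 : between lo hi y2) by (apply (between_convex H1 H2); lra).
    assert (F1 : f y1 < u) by (rewrite <- V2; apply Inc; try assumption; lra).
    assert (F2 : u < f y2) by (rewrite <- V2; apply Inc; try assumption; lra).

    refine (filter_imp _ _ _ (@between_locally (f y1) (f y2) u (conj F1 F2))).
    intros v [G1 G2]. apply He.
    destruct (Val y1 y2 v B1 B2 (conj G1 G2)) as [V3 _].
    change (Rabs (psi v - psi u) < e). apply Rabs_def1; lra. }

  (* A margin around [u], because the rule for the derivative of an inverse is applied on the closed
     interval [[u - e, u + e]]. *)
  assert (L : exists e, 0 < e /\ f x1 < u - e /\ u + e < f x2).
  { exists (Rmin (u - f x1) (f x2 - u) / 2).
    pose proof (Rmin_l (u - f x1) (f x2 - u)). pose proof (Rmin_r (u - f x1) (f x2 - u)).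
    assert (0 < Rmin (u - f x1) (f x2 - u)) by (apply Rmin_pos; lra). lra. }
  destruct L as [e [E1 [E2 E3]]].
  assert (Wu : forall v, u - e <= v <= u + e -> x1 < psi v < x2 /\ f (psi v) = v).
  { intros v Hv. apply Val; try assumption. lra. }
  assert (Bv : forall v, u - e <= v <= u + e -> between lo hi (psi v)).
  { intros v Hv. apply (between_convex H1 H2). pose proof (proj1 (Wu v Hv)). lra. }
  assert (Mono : forall v w, u - e <= v <= u + e -> u - e <= w <= u + e -> v <= w -> psi v <= psi w).
  { intros v w Hv Hw Hvw. destruct (Rle_lt_dec (psi v) (psi w)) as [E | E]; [exact E |].
    apply Inc in E; [| now apply Bv..].
    rewrite (proj2 (Wu v Hv)), (proj2 (Wu w Hw)) in E. lra. }
  assert (Prf : forall a, psi (u - e) <= a <= psi (u + e) -> derivable_pt f a).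
  { intros a Ha. exists (df a). apply is_derive_Reals, H.
    apply (between_convex (Bv (u - e) ltac:(lra)) (Bv (u + e) ltac:(lra)) Ha). }
  assert (Pu : psi (u - e) <= psi u <= psi (u + e)) by (split; apply Mono; lra).
  assert (Epr : derive_pt f (psi u) (Prf (psi u) Pu) = df (psi u)).
  { apply derive_pt_eq_0. now apply is_derive_Reals. }
  replace (/ df (psi u)) with (1 / derive_pt f (psi u) (Prf (psi u) Pu))
    by (rewrite Epr; field; lra).
  apply is_derive_Reals.
  apply (@derivable_pt_lim_recip_interv f psi (u - e) (u + e) u Prf Cu); try lra.
  intros v Hv. now apply Wu.
Qed.

(** * The coordinate of a potential well *)

Lemma analytic_on_C1 (P : R -> R) (lo hi : Rbar) (x : R) :
  analytic_on P lo hi -> between lo hi x -> C1_at P x /\ C1_at (Derive P) x.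
Proof.
intros H Hx. specialize (H x Hx). split; apply analytic_at_C1; [exact H |].
now apply analytic_at_derive.
Qed.

Lemma continuous_pos (f : R -> R) (x : R) :
  continuous f x -> 0 < f x -> locally x (fun z => 0 < f z).
Proof. intros Hc H. exact (Hc _ (open_gt 0 (f x) H)). Qed.

Lemma C1_at_sqrt2 (f : R -> R) (x : R) :
  C1_at f x -> 0 < f x -> C1_at (fun z => sqrt (2 * f z)) x.
Proof.
intros Hf Hx.
apply C1_at_of_is_derive with (fun z => Derive f z / sqrt (2 * f z)).
- refine (filter_imp _ _ _ (filter_and _ _ (proj1 Hf) (continuous_pos (C1_at_cont Hf) Hx))).
  intros z [H1 H2].
  assert (0 < sqrt (2 * f z)) by (apply sqrt_lt_R0; lra).
  apply is_derive_eq with (2 * Derive f z / (2 * sqrt (2 * f z))); [| field; lra].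
  apply (is_derive_sqrt (fun y => 2 * f y)); [| lra].
  apply is_derive_scal. now apply Derive_correct.
- assert (Cf := proj2 (continuity_pt_filterlim _ _) (C1_at_cont Hf)).
  assert (Cf' := proj2 (continuity_pt_filterlim _ _) (proj2 Hf)).
  apply continuity_pt_filterlim. apply continuity_pt_div.
  + exact Cf'.
  + apply (continuity_pt_comp (fun z => 2 * f z) sqrt).
    * apply continuity_pt_mult; [apply continuity_pt_const; now intros ? ? | exact Cf].
    * apply continuity_pt_sqrt. lra.
  + assert (0 < sqrt (2 * f x)) by (apply sqrt_lt_R0; lra). lra.
Qed.

(** Common ground of [potential g] and of an arbitrary solution of the Urabe equation, so that one
    coordinate serves both. *)
Definition normal_potential (P : R -> R) (lo hi : Rbar) : Prop :=
  analytic_on P lo hi /\ P 0 = 0 /\ Derive P 0 = 0 /\ Derive_n P 2 0 = 1.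

(* [sgn x * sqrt (2 P x)], in a form that is visibly smooth at [0] *)
Definition amplitude (P : R -> R) (x : R) : R := x * sqrt (2 * divx (divx P) x).

Section NormalPotential.

Variables (P : R -> R) (lo hi : Rbar).
Hypothesis h0 : between lo hi 0.
Hypothesis HP : normal_potential P lo hi.

Lemma normal_divx_0 : divx P 0 = 0.
Proof. rewrite divx_0. apply HP. Qed.

Lemma normal_factor2 (x : R) : x ^ 2 * divx (divx P) x = P x.
Proof.
replace (x ^ 2 * divx (divx P) x) with (x * (x * divx (divx P) x)) by ring.
rewrite (mul_divx x normal_divx_0). apply mul_divx, HP.
Qed.

Lemma normal_factor1 (x : R) : x * divx (Derive P) x = Derive P x.
Proof. apply mul_divx, HP. Qed.

Lemma normal_C1_factor1 (x : R) : between lo hi x -> C1_at (divx (Derive P)) x.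
Proof.
intros Hx. destruct HP as [Ha [H0 [H1 H2]]].
apply C1_at_divx; [exact H1 | now apply (analytic_on_C1 Ha) |].
apply analytic_at_derive. now apply Ha.
Qed.

Lemma normal_C1_factor2 (x : R) : between lo hi x -> C1_at (divx (divx P)) x.
Proof.
intros Hx. destruct HP as [Ha [H0 [H1 H2]]].
assert (A0 := Ha 0 h0).
apply C1_at_divx.
- exact normal_divx_0.
- apply C1_at_divx; [exact H0 | now apply (analytic_on_C1 Ha) | exact A0].
- now apply divx_series.
Qed.

Lemma normal_factor1_0 : divx (Derive P) 0 = 1.
Proof. rewrite divx_0. apply HP. Qed.

Lemma normal_factor2_0 : divx (divx P) 0 = 1 / 2.
Proof.
destruct HP as [Ha [H0 [H1 H2]]].
rewrite divx_0, (proj2 (divx_series H0 (Ha 0 h0))), H2. reflexivity.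
Qed.

Lemma amplitude_sqr (x : R) : 0 <= divx (divx P) x -> amplitude P x ^ 2 = 2 * P x.
Proof.
intros H. unfold amplitude. rewrite Rpow_mult_distr, pow2_sqrt by lra.
rewrite <- normal_factor2. ring.
Qed.

(** This is [h' = P' / h] with a factor [x] cancelled above and below, which is why it survives at
    0. Only the sign of the factor at [x] enters, so the formula also holds at turning points and
    applies outside any well. *)
Lemma amplitude_is_derive (x : R) :
  between lo hi x -> 0 < divx (divx P) x ->
  is_derive (amplitude P) x (divx (Derive P) x / sqrt (2 * divx (divx P) x)).
Proof.
intros Hx Hp. set (B := divx (divx P)) in *.
assert (Hs : 0 < sqrt (2 * B x)) by (apply sqrt_lt_R0; lra).
assert (CB := normal_C1_factor2 Hx). fold B in CB.
assert (DB := C1_at_is_derive CB).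
(* The derivative of [P = x^2 B], divided by [x]. At 0 it reads [1 = 2 * (1 / 2)], by the
   normalization. *)
assert (E : divx (Derive P) x = 2 * B x + x * Derive B x).
{ destruct (Req_dec x 0) as [-> | Hx0].
  - unfold B. rewrite normal_factor1_0, normal_factor2_0. field.
  - apply Rmult_eq_reg_l with x; [| exact Hx0]. rewrite normal_factor1.
    apply is_derive_unique. apply is_derive_ext with (fun z => z ^ 2 * B z).
    { intros z. apply normal_factor2. }
    auto_derive; [now exists (Derive B x) |].
    change (Derive (fun x0 => B x0) x) with (Derive B x). ring. }
rewrite E. unfold amplitude. fold B.
auto_derive.
- split; [now exists (Derive B x) | lra].
- change (Derive (fun x0 => B x0) x) with (Derive B x).
  assert (S2 : sqrt (2 * B x) * sqrt (2 * B x) = 2 * B x) by (apply sqrt_sqrt; lra).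
  apply Rmult_eq_reg_r with (sqrt (2 * B x)); [| lra].
  field_simplify; [| lra | lra]. simpl. rewrite Rmult_1_r, S2. field.
Qed.

(** * The well between two turning points *)

Section Well.

Variables (a0 b0 c0 : R).
Hypotheses (ha0 : between lo hi a0) (hb0 : between lo hi b0) (hab : a0 < 0 < b0).
Hypotheses (hPa : P a0 = c0) (hPb : P b0 = c0).
Hypothesis Hpos : forall x, a0 < x < b0 -> x <> 0 -> 0 < x * Derive P x.

Lemma well_between (x : R) : a0 <= x <= b0 -> between lo hi x.
Proof. exact (between_convex ha0 hb0). Qed.

Lemma well_is_derive (x : R) : a0 <= x <= b0 -> is_derive P x (Derive P x).
Proof.
intros Hx. apply C1_at_is_derive. now apply (analytic_on_C1 (proj1 HP)), well_between.
Qed.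

Lemma well_mean_value (x y : R) :
  a0 <= x -> y <= b0 -> x < y ->
  exists t, x < t < y /\ P y - P x = Derive P t * (y - x).
Proof.
intros Hx Hy Hxy. destruct (@MVT_cor2 P (Derive P) x y Hxy) as [t [E Ht]].
- intros t Ht. apply is_derive_Reals, well_is_derive. lra.
- now exists t.
Qed.

Lemma well_potential_pos (x : R) : a0 <= x <= b0 -> x <> 0 -> 0 < P x.
Proof.
intros Hx Hx0. assert (P0 : P 0 = 0) by apply HP.
destruct (Rtotal_order x 0) as [L | [L | L]]; [| easy |].
- destruct (@well_mean_value x 0) as [t [Ht E]]; try lra.
  assert (Q := @Hpos t ltac:(lra) ltac:(lra)). nra.
- destruct (@well_mean_value 0 x) as [t [Ht E]]; try lra.
  assert (Q := @Hpos t ltac:(lra) ltac:(lra)). nra.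
Qed.

Lemma well_potential_lt (x : R) : a0 < x < b0 -> P x < c0.
Proof.
intros Hx. assert (P0 : P 0 = 0) by apply HP.
destruct (Req_dec x 0) as [-> | Hx0].
- rewrite P0, <- hPb. apply well_potential_pos; lra.
- destruct (Rtotal_order x 0) as [L | [L | L]]; [| easy |].
  + destruct (@well_mean_value a0 x) as [t [Ht E]]; try lra.
    assert (Q := @Hpos t ltac:(lra) ltac:(lra)). nra.
  + destruct (@well_mean_value x b0) as [t [Ht E]]; try lra.
    assert (Q := @Hpos t ltac:(lra) ltac:(lra)). nra.
Qed.

Lemma well_factor2_pos (x : R) : a0 <= x <= b0 -> 0 < divx (divx P) x.
Proof.
intros Hx. destruct (Req_dec x 0) as [-> | Hx0].
- rewrite normal_factor2_0. lra.
- assert (H := well_potential_pos Hx Hx0). rewrite <- normal_factor2 in H.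
  assert (0 < x ^ 2) by (apply pow2_gt_0; exact Hx0). nra.
Qed.

Lemma well_factor1_pos (x : R) : a0 < x < b0 -> 0 < divx (Derive P) x.
Proof.
intros Hx. destruct (Req_dec x 0) as [-> | Hx0].
- rewrite normal_factor1_0. lra.
- assert (H := Hpos Hx Hx0). rewrite <- normal_factor1 in H.
  assert (0 < x * x) by nra. nra.
Qed.

Lemma well_amplitude_sqr (x : R) : a0 <= x <= b0 -> amplitude P x ^ 2 = 2 * P x.
Proof. intros Hx. apply amplitude_sqr. left. now apply well_factor2_pos. Qed.

Lemma well_amplitude_sgn (x : R) : a0 <= x <= b0 -> x <> 0 -> 0 < x * amplitude P x.
Proof.
intros Hx Hx0. unfold amplitude.
assert (0 < sqrt (2 * divx (divx P) x)).
{ apply sqrt_lt_R0. pose proof (well_factor2_pos Hx). lra. }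
assert (0 < x * x) by nra. nra.
Qed.

Lemma well_energy_pos : 0 < c0.
Proof. rewrite <- hPb. apply well_potential_pos; lra. Qed.

Lemma well_amplitude_right : amplitude P b0 = sqrt (2 * c0).
Proof.
pose proof well_energy_pos.
symmetry. apply sqrt_lem_1; [lra | |].
- pose proof (@well_amplitude_sgn b0 ltac:(lra) ltac:(lra)). nra.
- rewrite <- hPb, <- well_amplitude_sqr by lra. ring.
Qed.

Lemma well_amplitude_left : amplitude P a0 = - sqrt (2 * c0).
Proof.
pose proof well_energy_pos. apply Ropp_eq_reg. rewrite Ropp_involutive.
symmetry. apply sqrt_lem_1; [lra | |].
- pose proof (@well_amplitude_sgn a0 ltac:(lra) ltac:(lra)). nra.
- rewrite <- hPa, <- well_amplitude_sqr by lra. ring.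
Qed.

Lemma well_amplitude_lt (x : R) :
  a0 < x < b0 -> - sqrt (2 * c0) < amplitude P x < sqrt (2 * c0).
Proof.
intros Hx. pose proof (well_potential_lt Hx). pose proof well_energy_pos.
pose proof (@well_amplitude_sqr x ltac:(lra)) as E.
assert (S : sqrt (2 * c0) * sqrt (2 * c0) = 2 * c0) by (apply sqrt_sqrt; lra).
assert (0 < sqrt (2 * c0)) by (apply sqrt_lt_R0; lra).
simpl in E. split; nra.
Qed.

(** This is [1 / h'], that is, [phi'] expressed in the variable [x]. Away from 0 it equals
    [h / P']. *)
Definition inv_rate (x : R) : R := sqrt (2 * divx (divx P) x) / divx (Derive P) x.

Lemma well_C1_inv_rate (x : R) : a0 < x < b0 -> C1_at inv_rate x.
Proof.
intros Hx. assert (Hb : between lo hi x) by (apply well_between; lra).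
apply C1_at_div.
- apply C1_at_sqrt2; [now apply normal_C1_factor2 |]. apply well_factor2_pos. lra.
- now apply normal_C1_factor1.
- pose proof (well_factor1_pos Hx). lra.
Qed.

Lemma well_inv_rate_pos (x : R) : a0 < x < b0 -> 0 < inv_rate x.
Proof.
intros Hx. apply Rdiv_lt_0_compat; [| now apply well_factor1_pos].
apply sqrt_lt_R0. pose proof (@well_factor2_pos x ltac:(lra)). lra.
Qed.

Lemma well_amplitude_is_derive (x : R) :
  a0 < x < b0 -> is_derive (amplitude P) x (/ inv_rate x).
Proof.
intros Hx. pose proof (@well_factor2_pos x ltac:(lra)). pose proof (well_factor1_pos Hx).
apply is_derive_eq with (divx (Derive P) x / sqrt (2 * divx (divx P) x)).
- apply amplitude_is_derive; [| easy]. apply well_between. lra.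
- assert (0 < sqrt (2 * divx (divx P) x)) by (apply sqrt_lt_R0; lra).
  unfold inv_rate. field. lra.
Qed.

Lemma well_inv_rate_mul (x : R) : a0 < x < b0 -> Derive P x * inv_rate x = amplitude P x.
Proof.
intros Hx. pose proof (well_factor1_pos Hx). rewrite <- normal_factor1.
unfold inv_rate, amplitude. field. lra.
Qed.

Definition inv_amplitude_derive2 (x : R) : R :=
  (Derive P x ^ 2 - 2 * P x * Derive (Derive P) x) / Derive P x ^ 3.

(** With [q] for [inv_rate], [phi' = q o phi] gives [phi'' = (q' q) o phi], so the left side is
    [phi''] in the variable [x]. Differentiating [q = h / P'] with [h' = 1 / q], the square roots
    disappear through [h^2 = 2 P]. *)
Lemma well_Derive_inv_rate (x : R) :
  a0 < x < b0 -> x <> 0 -> Derive inv_rate x * inv_rate x = inv_amplitude_derive2 x.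
Proof.
intros Hx Hx0. assert (Hb : between lo hi x) by (apply well_between; lra).
assert (Hg : Derive P x <> 0) by (pose proof (Hpos Hx Hx0); nra).
assert (Hh : amplitude P x <> 0).
{ pose proof (@well_amplitude_sgn x ltac:(lra) Hx0). nra. }
assert (Eq := well_inv_rate_mul Hx).
assert (Es := @well_amplitude_sqr x ltac:(lra)).
assert (Hq : inv_rate x = amplitude P x / Derive P x) by (rewrite <- Eq; now field).
assert (D : is_derive inv_rate x
  ((/ inv_rate x * Derive P x - amplitude P x * Derive (Derive P) x) / Derive P x ^ 2)).
{ apply is_derive_ext_loc with (fun z => amplitude P z / Derive P z).
  - assert (L : locally x (between a0 b0)) by (apply between_locally; exact Hx).
    refine (filter_imp _ _ _ (filter_and _ _ L (locally_neq Hx0))).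
    intros z [Hz Hz0]. change (amplitude P z / Derive P z = inv_rate z).
    rewrite <- (well_inv_rate_mul Hz). field.
    pose proof (Hpos Hz Hz0). nra.
  - apply is_derive_div; [now apply well_amplitude_is_derive | | exact Hg].
    apply C1_at_is_derive. now apply (analytic_on_C1 (proj1 HP)). }
rewrite (is_derive_unique _ _ _ D), Hq. unfold inv_amplitude_derive2. rewrite <- Es. field. now split.
Qed.

(** The range of [u] is open because [P'] may vanish at [a0] or [b0], where [phi] would lose its
    derivative. The identity [P' (phi u) * f u = u] is the one that makes the force linear in
    [u]. *)
Lemma well_coordinate :
  exists phi f f' : R -> R,
    (forall x, a0 < x < b0 -> phi (amplitude P x) = x) /\
    forall u, - sqrt (2 * c0) < u < sqrt (2 * c0) ->
      a0 < phi u < b0 /\ amplitude P (phi u) = u /\ is_derive phi u (f u) /\ 0 < f u /\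
      is_derive f u (f' u) /\ continuous f' u /\ Derive P (phi u) * f u = u /\
      (u <> 0 -> f' u = inv_amplitude_derive2 (phi u)).
Proof.
destruct (@inverse_function a0 b0 (amplitude P) (fun x => / inv_rate x)) as [phi [H1 H2]].
{ intros x Hx. split; [now apply well_amplitude_is_derive |].
  apply Rinv_0_lt_compat. now apply well_inv_rate_pos. }
assert (Cont : forall x, a0 <= x <= b0 -> continuous (amplitude P) x).
{ intros x Hx. eapply is_derive_cont, amplitude_is_derive.
  - now apply well_between.
  - now apply well_factor2_pos. }
assert (Inv : forall u, - sqrt (2 * c0) < u < sqrt (2 * c0) ->
  a0 < phi u < b0 /\ amplitude P (phi u) = u /\ is_derive phi u (inv_rate (phi u))).
{ intros u Hu.
  (* The inverse function needs [u] bracketed by values at interior points. Since [amplitude] is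
     continuous up to the ends, with values [- sqrt (2 c0)] and [sqrt (2 c0)] there, points close
     enough to [a0] and [b0] will do; the minimum or maximum with 0 keeps them inside the well. *)
  assert (L : exists x1, a0 < x1 < b0 /\ amplitude P x1 < u).
  { assert (F : amplitude P a0 < u) by (rewrite well_amplitude_left; lra).
    assert (Q := @Cont a0 ltac:(lra) _ (open_lt u (amplitude P a0) F)).
    destruct (locally_ball Q) as [d [Hd Q']].
    exists (Rmin (a0 + d / 2) 0). split.
    - split; [apply Rmin_glb_lt; lra |]. pose proof (Rmin_r (a0 + d / 2) 0). lra.
    - apply Q'. pose proof (Rmin_l (a0 + d / 2) 0).
      assert (a0 < Rmin (a0 + d / 2) 0) by (apply Rmin_glb_lt; lra).
      apply Rabs_def1; lra. }
  assert (M : exists x2, a0 < x2 < b0 /\ u < amplitude P x2).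
  { assert (F : u < amplitude P b0) by (rewrite well_amplitude_right; lra).
    assert (Q := @Cont b0 ltac:(lra) _ (open_gt u (amplitude P b0) F)).
    destruct (locally_ball Q) as [d [Hd Q']].
    exists (Rmax (b0 - d / 2) 0). split.
    - split; [pose proof (Rmax_r (b0 - d / 2) 0); lra | apply Rmax_lub_lt; lra].
    - apply Q'. pose proof (Rmax_l (b0 - d / 2) 0).
      assert (Rmax (b0 - d / 2) 0 < b0) by (apply Rmax_lub_lt; lra).
      apply Rabs_def1; lra. }
  destruct L as [x1 [L1 L2]]. destruct M as [x2 [M1 M2]].
  destruct (H2 x1 x2 u L1 M1 (conj L2 M2)) as [K1 [K2 K3]].
  assert (K : a0 < phi u < b0) by lra.
  split; [exact K |]. split; [exact K2 |].
  apply is_derive_eq with (1 := K3). apply Rinv_inv. }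
exists phi, (fun u => inv_rate (phi u)),
  (fun u => Derive inv_rate (phi u) * inv_rate (phi u)).
split; [exact H1 |].
intros u Hu. destruct (Inv u Hu) as [I1 [I2 I3]].
assert (Cq := well_C1_inv_rate I1).
assert (Cphi := is_derive_cont I3).
split; [exact I1 |]. split; [exact I2 |]. split; [exact I3 |].
split; [now apply well_inv_rate_pos |]. split; [| split; [| split]].
- apply is_derive_eq with (scal (inv_rate (phi u)) (Derive inv_rate (phi u))).
  + apply (is_derive_comp (V := R_NormedModule) inv_rate phi); [| exact I3].
    now apply C1_at_is_derive.
  + unfold scal; simpl; unfold mult; simpl. ring.
- apply (continuous_mult (K := R_AbsRing) (fun v => Derive inv_rate (phi v)) (fun v => inv_rate (phi v))).
  + apply (continuous_comp phi (Derive inv_rate)); [exact Cphi | apply Cq].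
  + apply (continuous_comp phi inv_rate); [exact Cphi | exact (C1_at_cont Cq)].
- now rewrite well_inv_rate_mul.
- intros Hu0. apply well_Derive_inv_rate; [exact I1 |].
  intros E. apply Hu0. rewrite <- I2, E. unfold amplitude. ring.
Qed.

End Well.
End NormalPotential.

(** * Motion in polar coordinates *)

Lemma cos_lt_1 (d : R) : 0 < d < 2 * PI -> cos d < 1.
Proof.
intros Hd. replace d with (2 * (d / 2)) by field. rewrite cos_2a_sin.
assert (0 < sin (d / 2)) by (apply sin_gt_0; lra). nra.
Qed.

Lemma polar_angle (u y r : R) :
  0 < r -> u ^ 2 + y ^ 2 = r ^ 2 -> exists th, u = r * sin th /\ y = r * cos th.
Proof.
intros Hr E.
assert (Hy : -1 <= y / r <= 1).
{ assert (- r <= y <= r) by (split; nra).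
  split; [apply Rmult_le_reg_r with r | apply Rmult_le_reg_r with r]; try lra;
    unfold Rdiv; rewrite Rmult_assoc, Rinv_l by lra; lra. }
assert (C : cos (acos (y / r)) = y / r) by now apply cos_acos.
assert (S : r * sin (acos (y / r)) = Rabs u).
{ rewrite sin_acos by exact Hy.
  replace (1 - (y / r)²) with ((u / r)²).
  - rewrite sqrt_Rsqr_abs, Rabs_div by lra. rewrite (Rabs_right r) by lra. field. lra.
  - unfold Rsqr. assert (u * u = r * r - y * y) by nra.
    replace (u / r * (u / r)) with (u * u / (r * r)) by (field; lra).
    rewrite H. field. lra. }
(* [acos] selects the half turn where the sine is nonnegative; the opposite angle serves negative
   [u]. *)
destruct (Rle_lt_dec 0 u) as [Hu | Hu].
- exists (acos (y / r)). rewrite C, S, Rabs_pos_eq by exact Hu. split; [easy | field; lra].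
- exists (- acos (y / r)). rewrite cos_neg, sin_neg, C.
  split; [| field; lra].
  rewrite Ropp_mult_distr_r_reverse, S, Rabs_left by exact Hu. ring.
Qed.

Section Polar.

Variables (g : R -> R) (lo hi : Rbar) (phi f f' : R -> R) (r0 : R).
Hypothesis Hphi : forall u, - r0 < u < r0 ->
  between lo hi (phi u) /\ is_derive phi u (f u) /\ 0 < f u /\
  is_derive f u (f' u) /\ continuous f' u /\ g (phi u) * f u = u.
Hypothesis phi_inj : forall u v, - r0 < u < r0 -> - r0 < v < r0 -> phi u = phi v -> u = v.

Definition polar_period (r : R) : R := RInt (fun th => f (r * sin th)) 0 (2 * PI).

Lemma polar_range (r th : R) : 0 < r < r0 -> - r0 < r * sin th < r0.
Proof. intros Hr. pose proof (SIN_bound th). split; nra. Qed.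

Lemma polar_cont (r th : R) : 0 < r < r0 -> continuous (fun s => f (r * sin s)) th.
Proof.
intros Hr. apply (continuous_comp (fun s => r * sin s) f).
- apply ex_derive_cont. auto_derive. easy.
- destruct (Hphi (polar_range th Hr)) as [_ [_ [_ [H _]]]]. exact (is_derive_cont H).
Qed.

(** * Motion on a circle of fixed radius *)

Section Clock.

Variable r : R.
Hypothesis Hr : 0 < r < r0.

(** Time spent in going from angle 0 to angle [th]. The angle obeys [th' = 1 / f (r sin th)], a
    separable equation, so the orbit is built by inverting this function and no existence theorem
    for differential equations is called on. *)
Definition clock (th : R) : R := RInt (fun s => f (r * sin s)) 0 th.

Lemma clock_is_derive (th : R) : is_derive clock th (f (r * sin th)).
Proof.
apply (is_derive_RInt (V := R_NormedModule) (fun s => f (r * sin s)) clock 0 th); [| now apply polar_cont].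
apply filter_forall. intros b. apply (RInt_correct (V := R_CompleteNormedModule)).
apply (ex_RInt_continuous (V := R_CompleteNormedModule)). intros z _. now apply polar_cont.
Qed.

Lemma clock_rate_pos (th : R) : 0 < f (r * sin th).
Proof. now apply Hphi, polar_range. Qed.

Lemma clock_lt (x y : R) : x < y -> clock x < clock y.
Proof.
intros H. apply derive_pos_lt with (fun th => f (r * sin th)); [| | exact H]; intros t _.
- apply clock_is_derive.
- apply clock_rate_pos.
Qed.

Lemma clock_0 : clock 0 = 0.
Proof. exact (RInt_point 0 _). Qed.

Lemma polar_period_pos : 0 < polar_period r.
Proof.
pose proof PI_RGT_0. assert (H0 := @clock_lt 0 (2 * PI) ltac:(lra)).
now rewrite clock_0 in H0.
Qed.

Lemma clock_turn (th : R) : clock (th + 2 * PI) = clock th + polar_period r.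
Proof.
assert (D : forall t, is_derive (fun s => clock (s + 2 * PI) - clock s) t 0).
{ intros t. apply is_derive_eq with (scal 1 (f (r * sin (t + 2 * PI))) - f (r * sin t)).
  - apply (is_derive_minus (V := R_NormedModule) (fun s => clock (s + 2 * PI)) clock).
    + apply (is_derive_comp (V := R_NormedModule) clock (fun s => s + 2 * PI)).
      * apply clock_is_derive.
      * auto_derive; [easy | ring].
    + apply clock_is_derive.
  - rewrite sin_plus, sin_2PI, cos_2PI. unfold scal; simpl; unfold mult; simpl.
    rewrite Rmult_1_l. replace (r * (sin t * 1 + cos t * 0)) with (r * sin t) by ring. ring. }
assert (E := @zero_derive_const (fun s => clock (s + 2 * PI) - clock s) 0 th
  (fun t _ => D t) (fun t _ => is_derive_cont (D t))).
simpl in E. rewrite Rplus_0_l, clock_0 in E.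
change (clock (2 * PI)) with (polar_period r) in E. lra.
Qed.

(** Whole turns show that the clock is unbounded in both directions; hence every time is reached and
    the orbit is defined for all time. *)
Lemma clock_turns (n : nat) :
  clock (INR n * (2 * PI)) = INR n * polar_period r /\
  clock (- INR n * (2 * PI)) = - INR n * polar_period r.
Proof.
induction n as [| n [IH1 IH2]].
- simpl. rewrite Ropp_0, !Rmult_0_l. now rewrite clock_0.
- rewrite S_INR. split.
  + replace ((INR n + 1) * (2 * PI)) with (INR n * (2 * PI) + 2 * PI) by ring.
    rewrite clock_turn, IH1. ring.
  + assert (E := clock_turn (- (INR n + 1) * (2 * PI))).
    replace (- (INR n + 1) * (2 * PI) + 2 * PI) with (- INR n * (2 * PI)) in E by ring.
    rewrite IH2 in E. lra.
Qed.

Lemma angle_of_time :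
  exists psi : R -> R,
    (forall th, psi (clock th) = th) /\
    forall t, clock (psi t) = t /\ is_derive psi t (/ f (r * sin (psi t))).
Proof.
destruct (@inverse_function m_infty p_infty clock (fun th => f (r * sin th))) as [psi [H1 H2]].
{ intros th _. split; [apply clock_is_derive | apply clock_rate_pos]. }
exists psi. split.
- intros th. now apply H1.
(* With [n] the integer part of [|t|] over the period, [n + 1] turns forward and backward bracket
   [t]. *)
- intros t. destruct (nfloor_ex (Rabs t / polar_period r)) as [n [_ Hn]].
  { apply Rdiv_le_0_compat; [apply Rabs_pos | apply polar_period_pos]. }
  pose proof polar_period_pos as Tp.
  assert (B : Rabs t < INR (S n) * polar_period r).
  { rewrite S_INR. apply Rmult_lt_reg_r with (/ polar_period r).
    - now apply Rinv_0_lt_compat.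
    - rewrite Rmult_assoc, Rinv_r by lra. unfold Rdiv in Hn. lra. }
  destruct (clock_turns (S n)) as [E1 E2].
  apply Rabs_lt_between in B.
  destruct (H2 (- INR (S n) * (2 * PI)) (INR (S n) * (2 * PI)) t) as [_ K]; try easy.
  rewrite E1, E2. lra.
Qed.

Lemma polar_solution (th0 : R) :
  exists x y : R -> R,
    is_solution g lo hi x y /\ x 0 = phi (r * sin th0) /\ y 0 = r * cos th0 /\
    minimal_period x y (polar_period r) /\
    forall t, exists th, x t = phi (r * sin th) /\ y t = r * cos th.
Proof.
destruct angle_of_time as [psi [P1 P2]].
(* The shift in time makes the motion start at angle [th0]. *)
set (p := fun t => psi (t + clock th0)).
assert (Dp : forall t, is_derive p t (/ f (r * sin (p t)))).
{ intros t. apply is_derive_eq with (scal 1 (/ f (r * sin (p t)))).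
  - apply (is_derive_comp (V := R_NormedModule) psi (fun s => s + clock th0)).
    + apply P2.
    + auto_derive; [easy | ring].
  - unfold scal; simpl; unfold mult; simpl. ring. }
assert (p0 : p 0 = th0) by (unfold p; now rewrite Rplus_0_l, P1).
assert (pT : forall t, p (t + polar_period r) = p t + 2 * PI).
{ intros t. unfold p.
  replace (t + polar_period r + clock th0) with (clock (psi (t + clock th0) + 2 * PI)).
  - apply P1.
  - rewrite clock_turn, (proj1 (P2 _)). ring. }
pose proof PI_RGT_0.
exists (fun t => phi (r * sin (p t))), (fun t => r * cos (p t)).
split; [| split; [| split; [| split]]].
- intros t. destruct (Hphi (polar_range (p t) Hr)) as [Q1 [Q2 [Q3 [_ [_ Q4]]]]].
  assert (exp : ex_derive p t) by (eexists; apply Dp).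
  assert (Ep : Derive (fun s => p s) t = / f (r * sin (p t))) by (apply is_derive_unique, Dp).
  split; [exact Q1 | split].
  + apply is_derive_eq with (scal (r * cos (p t) * / f (r * sin (p t))) (f (r * sin (p t)))).
    * apply (is_derive_comp (V := R_NormedModule) phi (fun s => r * sin (p s))); [exact Q2 |].
      auto_derive; [exact exp | rewrite Ep; ring].
    * unfold scal; simpl; unfold mult; simpl. field. lra.
  + auto_derive; [exact exp |]. rewrite Ep.
    assert (G : g (phi (r * sin (p t))) = r * sin (p t) * / f (r * sin (p t))).
    { rewrite <- Q4 at 2. field. lra. }
    rewrite G. ring.
- simpl. now rewrite p0.
- simpl. now rewrite p0.
- split.
  + split; [apply polar_period_pos |]. intros t. rewrite pT.
    now rewrite sin_plus, cos_plus, sin_2PI, cos_2PI, !Rmult_0_r, !Rmult_1_r, Rplus_0_r, Rminus_0_r.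
  (* A period [S] brings back the sine and the cosine of the angle. If it were shorter than the time
     of a turn, the angle would have advanced by an amount strictly between 0 and [2 PI], whose
     cosine is less than 1; yet the addition formula gives it cosine 1. *)
  + intros S [HS HSp]. destruct (HSp 0) as [E1 E2]. rewrite Rplus_0_l, p0 in E1, E2.
    apply phi_inj in E1; [| now apply polar_range..].
    apply Rmult_eq_reg_l in E1; [| lra]. apply Rmult_eq_reg_l in E2; [| lra].
    destruct (Rle_lt_dec (polar_period r) S) as [L | L]; [exact L | exfalso].
    assert (Hp : clock (p S) = S + clock th0) by apply P2.
    assert (L1 : th0 < p S).
    { destruct (Rle_lt_dec (p S) th0) as [[A | A] | A]; [| | exact A].
      - apply clock_lt in A. lra.
      - rewrite A in Hp. lra. }
    assert (L2 : p S < th0 + 2 * PI).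
    { assert (K := clock_turn th0).
      destruct (Rle_lt_dec (th0 + 2 * PI) (p S)) as [[A | A] | A]; [| | exact A].
      - apply clock_lt in A. lra.
      - rewrite <- A in Hp. lra. }
    assert (C := @cos_lt_1 (p S - th0) ltac:(lra)).
    rewrite cos_minus, E1, E2 in C. pose proof (sin2_cos2 th0) as Q. unfold Rsqr in Q. lra.
- intros t. now exists (p t).
Qed.

End Clock.

Lemma polar_period_is_derive (r : R) : 0 < r < r0 ->
  is_derive polar_period r (RInt (fun th => f' (r * sin th) * sin th) 0 (2 * PI)).
Proof.
intros Hr.
assert (D : forall s th, 0 < s < r0 ->
  is_derive (fun z => f (z * sin th)) s (f' (s * sin th) * sin th)).
{ intros s th Hs. destruct (Hphi (polar_range th Hs)) as [_ [_ [_ [H _]]]].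
  apply is_derive_eq with (scal (sin th) (f' (s * sin th))).
  - apply (is_derive_comp (V := R_NormedModule) f (fun z => z * sin th)); [exact H |].
    auto_derive; [easy | ring].
  - unfold scal; simpl; unfold mult; simpl. ring. }
assert (L : locally r (between 0 r0)) by (apply between_locally; exact Hr).
apply is_derive_eq with (RInt (fun th => Derive (fun u => f (u * sin th)) r) 0 (2 * PI)).
- apply (is_derive_RInt_param (fun s th => f (s * sin th))).
  + refine (filter_imp _ _ _ L). intros s Hs th _. eexists. now apply D.
  + intros th _.
    apply continuity_2d_pt_ext_loc with (fun s t => f' (s * sin t) * sin t).
    * destruct (locally_ball L) as [d [Hd L']]. exists (mkposreal d Hd).
      intros s t Hs _. symmetry. apply is_derive_unique, D. now apply L'.
    * apply continuity_2d_pt_mult.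
      -- apply continuity_1d_2d_pt_comp.
         ++ apply continuity_pt_filterlim. now apply Hphi, polar_range.
         ++ apply continuity_2d_pt_mult; [apply continuity_2d_pt_id1 |].
            apply continuity_1d_2d_pt_comp; [apply continuity_sin | apply continuity_2d_pt_id2].
      -- apply continuity_1d_2d_pt_comp; [apply continuity_sin | apply continuity_2d_pt_id2].
  + refine (filter_imp _ _ _ L). intros s Hs.
    apply (ex_RInt_continuous (V := R_CompleteNormedModule)). intros z _. now apply polar_cont.
- apply RInt_ext. intros th _. now apply is_derive_unique, D.
Qed.

Lemma polar_derive_cont (r th : R) : 0 < r < r0 ->
  continuous (fun th => f' (r * sin th)) th.
Proof.
intros Hr. apply (continuous_comp (fun s => r * sin s) f').
- apply ex_derive_cont. auto_derive. easy.
- now apply Hphi, polar_range.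
Qed.

(* [sin] has mean zero over a turn, so a constant may be subtracted from [f']. *)
Lemma polar_period_derive_sign (r k s : R) : 0 < r < r0 ->
  (forall u, - r0 < u < r0 -> u <> 0 -> 0 < s * ((f' u - k) * u)) ->
  0 < s * RInt (fun th => f' (r * sin th) * sin th) 0 (2 * PI).
Proof.
intros Hr H. pose proof PI_RGT_0.
set (F := fun th => f' (r * sin th) * sin th).
set (G := fun th => s * ((f' (r * sin th) - k) * sin th)).
assert (CF : forall th, continuous F th).
{ intros th. apply (continuous_mult (K := R_AbsRing)).
  - now apply polar_derive_cont.
  - apply ex_derive_cont. auto_derive. easy. }
assert (CG : forall th, continuous G th).
{ intros th. apply (continuous_ext (fun z => s * F z - s * k * sin z)).
  - intros z. refine (_ : @eq R _ _). unfold G, F. ring.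
  - apply (continuous_minus (V := R_NormedModule)).
    + apply (continuous_mult (K := R_AbsRing)); [apply continuous_const | apply CF].
    + apply ex_derive_cont. auto_derive. easy. }
assert (EG : forall a b, ex_RInt G a b).
{ intros a b. apply (ex_RInt_continuous (V := R_CompleteNormedModule)). intros z _. apply CG. }
assert (PG : forall th, sin th <> 0 -> 0 < G th).
{ intros th Hs. assert (K := H (r * sin th) (polar_range th Hr)
    ltac:(apply Rmult_integral_contrapositive; split; lra)).
  apply Rmult_lt_reg_l with r; [lra |]. rewrite Rmult_0_r. unfold G.
  replace (r * (s * ((f' (r * sin th) - k) * sin th)))
    with (s * ((f' (r * sin th) - k) * (r * sin th))) by ring. exact K. }
assert (S1 : is_RInt sin 0 (2 * PI) 0).
{ replace 0 with (minus (- cos (2 * PI)) (- cos 0)) at 2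
    by (rewrite cos_2PI, cos_0; unfold minus, plus, opp; simpl; ring).
  apply (is_RInt_derive (V := R_CompleteNormedModule) (fun z => - cos z) sin).
  - intros z _. auto_derive; [easy | ring].
  - intros z _. apply ex_derive_cont. auto_derive. easy. }
replace (s * RInt F 0 (2 * PI)) with (RInt G 0 (2 * PI)).
(* [G] vanishes together with the sine, so strict positivity is available on each open half turn
   separately. *)
- rewrite <- (RInt_Chasles G 0 PI (2 * PI)) by apply EG.
  apply Rplus_lt_0_compat; (apply RInt_gt_0; [lra | | now intros]); intros th Hth; apply PG.
  + pose proof (sin_gt_0 th ltac:(lra) ltac:(lra)). lra.
  + pose proof (sin_lt_0 th ltac:(lra) ltac:(lra)). lra.
- apply is_RInt_unique.
  apply (is_RInt_ext (fun z => s * F z - s * k * sin z)).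
  { intros z _. refine (_ : @eq R _ _). unfold G, F. ring. }
  replace (s * RInt F 0 (2 * PI)) with (minus (scal s (RInt F 0 (2 * PI))) (scal (s * k) 0))
    by (unfold minus, plus, opp, scal; simpl; unfold mult; simpl; ring).
  apply (is_RInt_minus (V := R_NormedModule)); apply (is_RInt_scal (V := R_NormedModule)).
  + apply (RInt_correct (V := R_CompleteNormedModule)).
    apply (ex_RInt_continuous (V := R_CompleteNormedModule)). intros z _. apply CF.
  + exact S1.
Qed.

End Polar.

(** * The period annulus *)

(** A Gronwall estimate: with [D] the squared distance of the two solutions and [L] a Lipschitz
    constant of [g], [D' <= (1 + L) D], so [D exp (- (1 + L) s)] cannot grow from its initial value
    0. *)
Lemma solution_unique_forward (g : R -> R) (lo hi : Rbar) (x1 y1 x2 y2 : R -> R) (t : R) :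
  (forall x, between lo hi x -> C1_at g x) ->
  is_solution g lo hi x1 y1 -> is_solution g lo hi x2 y2 ->
  x1 0 = x2 0 -> y1 0 = y2 0 -> 0 <= t -> x1 t = x2 t /\ y1 t = y2 t.
Proof.
intros Hg S1 S2 Ex Ey Ht.
assert (C1 : forall s, 0 <= s <= t -> continuity_pt x1 s).
{ intros s _. destruct (S1 s) as [_ [H _]]. apply continuity_pt_filterlim. exact (is_derive_cont H). }
assert (C2 : forall s, 0 <= s <= t -> continuity_pt x2 s).
{ intros s _. destruct (S2 s) as [_ [H _]]. apply continuity_pt_filterlim. exact (is_derive_cont H). }
(* [g] may have unbounded derivative on []lo, hi[]; both trajectories over [[0, t]] stay in a
   compact part of it, where a Lipschitz constant exists. *)
assert (Box : exists m M, between lo hi m /\ between lo hi M /\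
  forall s, 0 <= s <= t -> m <= x1 s <= M /\ m <= x2 s <= M).
{ destruct (continuity_ab_min x1 0 t Ht C1) as [i1 [I1 _]].
  destruct (continuity_ab_min x2 0 t Ht C2) as [i2 [I2 _]].
  destruct (continuity_ab_maj x1 0 t Ht C1) as [j1 [J1 _]].
  destruct (continuity_ab_maj x2 0 t Ht C2) as [j2 [J2 _]].
  exists (Rmin (x1 i1) (x2 i2)), (Rmax (x1 j1) (x2 j2)). split; [| split].
  - unfold Rmin. destruct (Rle_dec _ _); [apply S1 | apply S2].
  - unfold Rmax. destruct (Rle_dec _ _); [apply S2 | apply S1].
  - intros s Hs.
    pose proof (Rmin_l (x1 i1) (x2 i2)). pose proof (Rmin_r (x1 i1) (x2 i2)).
    pose proof (Rmax_l (x1 j1) (x2 j2)). pose proof (Rmax_r (x1 j1) (x2 j2)).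
    specialize (I1 s Hs). specialize (I2 s Hs). specialize (J1 s Hs). specialize (J2 s Hs).
    lra. }
destruct Box as [m [M [Bm [BM Box]]]].
assert (HmM : m <= M) by (pose proof (Box 0 ltac:(lra)); lra).
destruct (continuity_ab_maj (fun z => Rabs (Derive g z)) m M HmM) as [z0 [Lip _]].
{ intros z Hz. apply (continuity_pt_comp (Derive g) Rabs); [| apply Rcontinuity_abs].
  apply continuity_pt_filterlim. now apply Hg, (between_convex Bm BM). }
set (L := Rabs (Derive g z0)) in Lip.
assert (HL : 0 <= L) by apply Rabs_pos.
assert (LipG : forall s, 0 <= s <= t -> Rabs (g (x1 s) - g (x2 s)) <= L * Rabs (x1 s - x2 s)).
{ intros s Hs. destruct (Box s Hs) as [B1 B2].
  assert (Hull : forall z, Rmin (x2 s) (x1 s) <= z <= Rmax (x2 s) (x1 s) -> m <= z <= M).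
  { intros z. unfold Rmin, Rmax. destruct (Rle_dec _ _); lra. }
  destruct (@mean_value g (Derive g) (x2 s) (x1 s)) as [z [Hz E]].
  { intros z Hz. now apply C1_at_is_derive, Hg, (between_convex Bm BM), Hull. }
  rewrite E, Rabs_mult. apply Rmult_le_compat_r; [apply Rabs_pos |]. apply Lip. now apply Hull. }
set (D := fun s => (x1 s - x2 s) ^ 2 + (y1 s - y2 s) ^ 2).
set (dD := fun s => 2 * (x1 s - x2 s) * (y1 s - y2 s)
                    - 2 * (y1 s - y2 s) * (g (x1 s) - g (x2 s))).
assert (HD : forall s, is_derive (fun s => D s * exp (- (1 + L) * s)) s
  ((dD s - (1 + L) * D s) * exp (- (1 + L) * s))).
{ intros s. destruct (S1 s) as [_ [A1 A2]]. destruct (S2 s) as [_ [A3 A4]].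
  unfold D. auto_derive.
  - repeat split; eexists; eassumption.
  - change (Derive (fun x => x1 x) s) with (Derive x1 s).
    change (Derive (fun x => x2 x) s) with (Derive x2 s).
    change (Derive (fun x => y1 x) s) with (Derive y1 s).
    change (Derive (fun x => y2 x) s) with (Derive y2 s).
    rewrite (is_derive_unique _ _ _ A1), (is_derive_unique _ _ _ A2),
      (is_derive_unique _ _ _ A3), (is_derive_unique _ _ _ A4). unfold dD. ring. }
(* With [p], [q] the differences of positions and velocities, [2 p q <= p^2 + q^2] accounts for the
   1, and the Lipschitz bound with [2 |p| |q| <= p^2 + q^2] for the [L]. *)
assert (dD_le : forall s, 0 <= s <= t -> dD s <= (1 + L) * D s).
{ intros s Hs. specialize (LipG s Hs). unfold dD, D.
  set (p := x1 s - x2 s) in *. set (q := y1 s - y2 s) in *.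
  assert (K : - (q * (g (x1 s) - g (x2 s))) <= L * (Rabs p * Rabs q)).
  { apply Rle_trans with (1 := Rle_abs _). rewrite Rabs_Ropp, Rabs_mult.
    pose proof (Rabs_pos q). nra. }
  assert (Q : 2 * (Rabs p * Rabs q) <= p ^ 2 + q ^ 2).
  { rewrite <- (pow2_abs p), <- (pow2_abs q).
    pose proof (pow2_ge_0 (Rabs p - Rabs q)). nra. }
  pose proof (pow2_ge_0 (p - q)). nra. }
destruct (@mean_value (fun s => D s * exp (- (1 + L) * s))
  (fun s => (dD s - (1 + L) * D s) * exp (- (1 + L) * s)) 0 t) as [s [Hs E]].
{ intros s _. apply HD. }
rewrite Rmin_left, Rmax_right in Hs by exact Ht.
assert (D0 : D 0 = 0) by (unfold D; rewrite Ex, Ey; ring).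
simpl in E. rewrite D0 in E. specialize (dD_le s Hs).
pose proof (exp_pos (- (1 + L) * s)). pose proof (exp_pos (- (1 + L) * t)).
assert (0 <= ((1 + L) * D s - dD s) * exp (- (1 + L) * s)) by nra.
assert (DT : D t * exp (- (1 + L) * t) <= 0) by nra.
assert (D t <= 0) by nra. unfold D in *.
assert (0 <= (x1 t - x2 t) ^ 2) by apply pow2_ge_0.
assert (0 <= (y1 t - y2 t) ^ 2) by apply pow2_ge_0.
split; apply Rminus_diag_uniq; nra.
Qed.

(** The force depends on position alone, so reflecting the velocity compensates time reversal. This
    carries uniqueness to negative times. *)
Lemma solution_reverse (g : R -> R) (lo hi : Rbar) (x y : R -> R) :
  is_solution g lo hi x y -> is_solution g lo hi (fun t => x (- t)) (fun t => - y (- t)).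
Proof.
intros S t. destruct (S (- t)) as [H1 [H2 H3]]. split; [exact H1 | split].
- auto_derive; [now exists (y (- t)) |].
  change (Derive (fun x0 => x x0) (- t)) with (Derive x (- t)).
  rewrite (is_derive_unique _ _ _ H2). ring.
- auto_derive; [now exists (- g (x (- t))) |].
  change (Derive (fun x0 => y x0) (- t)) with (Derive y (- t)).
  rewrite (is_derive_unique _ _ _ H3). ring.
Qed.

Lemma solution_unique (g : R -> R) (lo hi : Rbar) (x1 y1 x2 y2 : R -> R) :
  (forall x, between lo hi x -> C1_at g x) ->
  is_solution g lo hi x1 y1 -> is_solution g lo hi x2 y2 ->
  x1 0 = x2 0 -> y1 0 = y2 0 -> forall t, x1 t = x2 t /\ y1 t = y2 t.
Proof.
intros Hg S1 S2 Ex Ey t. destruct (Rle_lt_dec 0 t) as [Ht | Ht].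
- now apply (@solution_unique_forward g lo hi).
- destruct (@solution_unique_forward g lo hi _ _ _ _ (- t) Hg
    (solution_reverse S1) (solution_reverse S2)) as [E1 E2].
  + now rewrite Ropp_0.
  + now rewrite Ropp_0, Ey.
  + lra.
  + simpl in E1, E2. rewrite Ropp_involutive in E1, E2. split; lra.
Qed.

Lemma minimal_period_eq (x1 y1 x2 y2 : R -> R) (T1 T2 : R) :
  (forall t, x1 t = x2 t /\ y1 t = y2 t) ->
  minimal_period x1 y1 T1 -> minimal_period x2 y2 T2 -> T1 = T2.
Proof.
intros E [[A1 A2] A3] [[B1 B2] B3]. apply Rle_antisym.
- apply A3. split; [exact B1 |]. intros t.
  rewrite !(proj1 (E _)), !(proj2 (E _)). apply B2.
- apply B3. split; [exact A1 |]. intros t.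
  rewrite <- !(proj1 (E _)), <- !(proj2 (E _)). apply A2.
Qed.

(** * Orbits and periods inside a reference well of energy [c0] *)

Section Annulus.

Variables (g : R -> R) (lo hi : Rbar).
Hypothesis h0 : between lo hi 0.
Hypothesis hg : analytic_on g lo hi.
Hypothesis hg0 : g 0 = 0.
Hypothesis hg1 : Derive g 0 = 1.

Lemma potential_is_derive (x : R) : between lo hi x -> is_derive (potential g) x (g x).
Proof.
intros Hx.
assert (Cg : forall z, between lo hi z -> continuous g z).
{ intros z Hz. apply C1_at_cont. now apply analytic_at_C1, hg. }
apply (is_derive_RInt (V := R_NormedModule) g (potential g) 0 x); [| now apply Cg].
refine (filter_imp _ _ _ (between_locally Hx)). intros b Hb.
apply (RInt_correct (V := R_CompleteNormedModule)).
apply (ex_RInt_continuous (V := R_CompleteNormedModule)). intros z Hz. apply Cg.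
revert Hz. unfold Rmin, Rmax. destruct (Rle_dec 0 b); intros Hz.
- exact (between_convex h0 Hb Hz).
- exact (between_convex Hb h0 Hz).
Qed.

Lemma Derive_potential (x : R) : between lo hi x -> Derive (potential g) x = g x.
Proof. intros Hx. now apply is_derive_unique, potential_is_derive. Qed.

Lemma Derive2_potential (x : R) :
  between lo hi x -> Derive (Derive (potential g)) x = Derive g x.
Proof.
intros Hx. apply Derive_ext_loc.
refine (filter_imp _ _ _ (between_locally Hx)). exact Derive_potential.
Qed.

Lemma potential_0 : potential g 0 = 0.
Proof. exact (RInt_point 0 g). Qed.

Lemma potential_normal : normal_potential (potential g) lo hi.
Proof.
split; [| split; [| split]].
- intros x Hx. apply analytic_at_primitive.
  + refine (filter_imp _ _ _ (between_locally Hx)). intros z Hz.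
    exists (g z). now apply potential_is_derive.
  + apply analytic_at_ext_loc with g; [| now apply hg].
    refine (filter_imp _ _ _ (between_locally Hx)). intros z Hz. now rewrite Derive_potential.
- exact potential_0.
- now rewrite Derive_potential.
- change (Derive (Derive (potential g)) 0 = 1). now rewrite Derive2_potential.
Qed.

Lemma field_C1 (x : R) : between lo hi x -> C1_at g x.
Proof. intros Hx. now apply analytic_at_C1, hg. Qed.

Variables (a0 b0 c0 : R).
Hypothesis tp0 : turning_points g lo hi c0 a0 b0.

Let P := potential g.

Lemma annulus_pos (x : R) : a0 < x < b0 -> x <> 0 -> 0 < x * Derive P x.
Proof.
intros Hx Hx0. destruct tp0 as [H1 [H2 [_ [_ [_ H]]]]].
unfold P. rewrite Derive_potential; [now apply H |].
apply (between_convex H1 H2). lra.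
Qed.

Lemma annulus_between (x : R) : a0 < x < b0 -> between lo hi x.
Proof.
intros Hx. destruct tp0 as [H1 [H2 _]]. apply (between_convex H1 H2). lra.
Qed.

Lemma annulus_coordinate :
  exists phi f f' : R -> R,
    (forall x, a0 < x < b0 -> phi (amplitude P x) = x) /\
    forall u, - sqrt (2 * c0) < u < sqrt (2 * c0) ->
      a0 < phi u < b0 /\ amplitude P (phi u) = u /\ is_derive phi u (f u) /\ 0 < f u /\
      is_derive f u (f' u) /\ continuous f' u /\ g (phi u) * f u = u /\
      (u <> 0 -> f' u = inv_amplitude_derive2 P (phi u)).
Proof.
pose proof tp0 as [H1 [H2 [H3 [H4 [H5 _]]]]].
destruct (well_coordinate h0 potential_normal H1 H2 H3 H4 H5 annulus_pos)
  as [phi [f [f' [W1 W2]]]].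
exists phi, f, f'. split; [exact W1 |].
intros u Hu. destruct (W2 u Hu) as [Q1 [Q2 [Q3 [Q4 [Q5 [Q6 [Q7 Q8]]]]]]].
rewrite Derive_potential in Q7; [tauto |]. now apply annulus_between.
Qed.

Variables (phi f f' : R -> R).
Let r0 := sqrt (2 * c0).
Hypothesis W1 : forall x, a0 < x < b0 -> phi (amplitude P x) = x.
Hypothesis W2 : forall u, - r0 < u < r0 ->
  a0 < phi u < b0 /\ amplitude P (phi u) = u /\ is_derive phi u (f u) /\ 0 < f u /\
  is_derive f u (f' u) /\ continuous f' u /\ g (phi u) * f u = u /\
  (u <> 0 -> f' u = inv_amplitude_derive2 P (phi u)).

Lemma annulus_polar (u : R) : - r0 < u < r0 ->
  between lo hi (phi u) /\ is_derive phi u (f u) /\ 0 < f u /\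
  is_derive f u (f' u) /\ continuous f' u /\ g (phi u) * f u = u.
Proof.
intros Hu. destruct (W2 Hu) as [Q1 [_ [Q3 [Q4 [Q5 [Q6 [Q7 _]]]]]]].
apply annulus_between in Q1. tauto.
Qed.

Lemma annulus_inj (u v : R) : - r0 < u < r0 -> - r0 < v < r0 -> phi u = phi v -> u = v.
Proof.
intros Hu Hv E. rewrite <- (proj1 (proj2 (W2 Hu))), <- (proj1 (proj2 (W2 Hv))). now rewrite E.
Qed.

Lemma annulus_le (u v : R) : - r0 < u -> v < r0 -> u <= v -> phi u <= phi v.
Proof.
intros Hu Hv [L | ->]; [left | now right].
apply derive_pos_lt with f; [| | exact L]; intros t Ht; apply annulus_polar; lra.
Qed.

Lemma annulus_amplitude_sqr (x : R) : a0 < x < b0 -> amplitude P x ^ 2 = 2 * P x.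
Proof.
intros Hx. pose proof tp0 as [H1 [H2 [H3 [H4 [H5 _]]]]].
apply (well_amplitude_sqr h0 potential_normal H1 H2 H3 annulus_pos). lra.
Qed.

Lemma annulus_amplitude_lt (x : R) : a0 < x < b0 -> - r0 < amplitude P x < r0.
Proof.
pose proof tp0 as [H1 [H2 [H3 [H4 [H5 _]]]]].
exact (@well_amplitude_lt _ _ _ h0 potential_normal _ _ _ H1 H2 H3 H4 H5 annulus_pos x).
Qed.

Lemma annulus_energy (u : R) : - r0 < u < r0 -> P (phi u) = u ^ 2 / 2.
Proof.
intros Hu. destruct (W2 Hu) as [Q1 [Q2 _]].
pose proof (annulus_amplitude_sqr Q1) as E. rewrite Q2 in E. lra.
Qed.

Lemma annulus_0 : phi 0 = 0.
Proof.
destruct tp0 as [_ [_ [H _]]]. rewrite <- (W1 H) at 2.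
f_equal. unfold amplitude. ring.
Qed.

Lemma annulus_radius (c : R) : 0 < c < c0 -> 0 < sqrt (2 * c) < r0 /\ sqrt (2 * c) ^ 2 = 2 * c.
Proof.
intros Hc. split; [split |].
- apply sqrt_lt_R0. lra.
- apply sqrt_lt_1; lra.
- apply pow2_sqrt. lra.
Qed.

(** Conservation of energy reads [h (x0)^2 + y0^2 = 2 c], which places the initial data at some
    angle on the circle of radius [sqrt (2 c)]. *)
Lemma annulus_solution (x0 y0 : R) :
  a0 < x0 < b0 -> 0 < y0 ^ 2 / 2 + P x0 < c0 ->
  exists x y : R -> R,
    is_solution g lo hi x y /\ x 0 = x0 /\ y 0 = y0 /\
    minimal_period x y (polar_period f (sqrt (2 * (y0 ^ 2 / 2 + P x0)))) /\
    forall t, phi (- sqrt (2 * (y0 ^ 2 / 2 + P x0))) <= x t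
                <= phi (sqrt (2 * (y0 ^ 2 / 2 + P x0))) /\
              y t ^ 2 / 2 + P (x t) = y0 ^ 2 / 2 + P x0.
Proof.
intros Hx Hc. set (c := y0 ^ 2 / 2 + P x0) in *.
destruct (annulus_radius Hc) as [Hr Er]. set (r := sqrt (2 * c)) in *.
destruct (@polar_angle (amplitude P x0) y0 r) as [th [E1 E2]]; [lra | |].
{ rewrite Er, annulus_amplitude_sqr by exact Hx. unfold c. field. }
destruct (polar_solution annulus_polar annulus_inj Hr th) as [x [y [S [X0 [Y0 [M C]]]]]].
exists x, y. split; [exact S |]. split; [now rewrite X0, <- E1, W1 |].
split; [now rewrite Y0, <- E2 |]. split; [exact M |].
intros t. destruct (C t) as [s [-> ->]].
pose proof (SIN_bound s) as Bs. pose proof (polar_range s Hr) as Rs.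
split; [split; apply annulus_le; nra |].
rewrite (annulus_energy Rs). pose proof (sin2_cos2 s) as Q. unfold Rsqr in Q.
replace ((r * cos s) ^ 2 / 2 + (r * sin s) ^ 2 / 2)
  with (r ^ 2 * (sin s * sin s + cos s * cos s) / 2) by field.
rewrite Q, Er. field.
Qed.

(** The sign of [x g x] is inherited from the reference well, and the potential is [u^2 / 2] in the
    coordinate, hence below [c] exactly when [|u| < sqrt (2 c)]. *)
Lemma annulus_turning_points (c : R) : 0 < c < c0 ->
  turning_points g lo hi c (phi (- sqrt (2 * c))) (phi (sqrt (2 * c))).
Proof.
intros Hc. destruct (annulus_radius Hc) as [Hr Er]. set (r := sqrt (2 * c)) in *.
assert (Rm : - r0 < - r < r0) by lra. assert (Rp : - r0 < r < r0) by lra.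
assert (Lt : forall u v, - r0 < u -> v < r0 -> u < v -> phi u < phi v).
{ intros u v Hu Hv L.
  apply derive_pos_lt with f; [| | exact L]; intros t Ht; apply annulus_polar; lra. }
split; [now apply annulus_polar |]. split; [now apply annulus_polar |].
split; [rewrite <- annulus_0; split; apply Lt; lra |].
assert (Em := annulus_energy Rm). assert (Ep := annulus_energy Rp). unfold P in Em, Ep.
split; [rewrite Em; nra |]. split; [rewrite Ep; nra |].
intros x Hx Hx0. destruct (W2 Rm) as [Qm _]. destruct (W2 Rp) as [Qp _].
assert (Hx' : a0 < x < b0) by lra. split.
- assert (Ru := annulus_amplitude_lt Hx'). set (u := amplitude P x) in *.
  assert (Eu : phi u = x) by (now apply W1).
  assert (- r < u).
  { destruct (Rle_lt_dec u (- r)) as [L | L]; [| exact L].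
    pose proof (@annulus_le u (- r) ltac:(lra) ltac:(lra) L). lra. }
  assert (u < r).
  { destruct (Rle_lt_dec r u) as [L | L]; [| exact L].
    pose proof (@annulus_le r u ltac:(lra) ltac:(lra) L). lra. }
  rewrite <- Eu. change (P (phi u) < c). rewrite annulus_energy by exact Ru. nra.
- destruct tp0 as [_ [_ [_ [_ [_ H]]]]]. now apply H.
Qed.

(** Otherwise [a0] or [b0] would lie in [[a, b]], where the potential is at most [c], although its
    value there is [c0]. Applies to turning points about which nothing else is known. *)
Lemma turning_points_nested (c a b : R) :
  c < c0 -> turning_points g lo hi c a b -> a0 < a /\ b < b0.
Proof.
intros Hc [_ [_ [H3 [H4 [H5 H6]]]]]. destruct tp0 as [_ [_ [K3 [K4 [K5 _]]]]]. split.
- destruct (Rle_lt_dec a a0) as [[L | L] | L]; [| | exact L].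
  + destruct (H6 a0); lra.
  + subst. lra.
- destruct (Rle_lt_dec b0 b) as [[L | L] | L]; [| | exact L].
  + destruct (H6 b0); lra.
  + subst. lra.
Qed.

Lemma annulus_period_of_energy (c : R) : 0 < c < c0 ->
  is_period_of_energy g lo hi c (polar_period f (sqrt (2 * c))).
Proof.
intros Hc. destruct (annulus_radius Hc) as [Hr Er].
assert (Rp : - r0 < sqrt (2 * c) < r0) by lra.
destruct (W2 Rp) as [Q _]. pose proof (annulus_energy Rp) as E.
assert (Ec : 0 ^ 2 / 2 + P (phi (sqrt (2 * c))) = c) by (rewrite E, Er; field).
destruct (@annulus_solution (phi (sqrt (2 * c))) 0 Q) as [x [y [S [_ [_ [M C]]]]]].
{ rewrite Ec. exact Hc. }
rewrite Ec in M, C.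
exists (phi (- sqrt (2 * c))), (phi (sqrt (2 * c))), x, y.
split; [now apply annulus_turning_points |]. now split.
Qed.

Lemma annulus_solution_period (x y : R -> R) (T : R) :
  is_solution g lo hi x y -> a0 < x 0 < b0 -> 0 < y 0 ^ 2 / 2 + P (x 0) < c0 ->
  minimal_period x y T -> T = polar_period f (sqrt (2 * (y 0 ^ 2 / 2 + P (x 0)))).
Proof.
intros S Hx Hc M.
destruct (annulus_solution Hx Hc) as [x' [y' [S' [X0 [Y0 [M' _]]]]]].
apply (@minimal_period_eq x y x' y'); [| exact M | exact M'].
now apply (@solution_unique g lo hi x y x' y' field_C1).
Qed.

(** The value is picked by [epsilon]. The orbit constructed above shows that there is something to
    pick; whichever orbit witnesses the choice starts inside the reference well with energy [c], so
    uniqueness of solutions fixes its period. *)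
Lemma annulus_period_function (c : R) : 0 < c < c0 ->
  period_function g lo hi c = polar_period f (sqrt (2 * c)).
Proof.
intros Hc. unfold period_function.
assert (Hex : exists T, is_period_of_energy g lo hi c T).
{ eexists. now apply annulus_period_of_energy. }
destruct (epsilon_spec (inhabits 0) _ Hex) as [a [b [x [y [TP [S [C M]]]]]]].
destruct (@turning_points_nested c a b ltac:(lra) TP) as [N1 N2].
destruct (C 0) as [C1 C2]. change (potential g (x 0)) with (P (x 0)) in C2.
rewrite <- C2 at 2. apply (@annulus_solution_period x y); [exact S | lra | lra | exact M].
Qed.

Lemma annulus_period_derive (c : R) : 0 < c < c0 ->
  is_derive (period_function g lo hi) c
    (/ sqrt (2 * c) * RInt (fun th => f' (sqrt (2 * c) * sin th) * sin th) 0 (2 * PI)).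
Proof.
intros Hc. destruct (annulus_radius Hc) as [Hr _].
apply is_derive_ext_loc with (fun z => polar_period f (sqrt (2 * z))).
- refine (filter_imp _ _ _ (@between_locally 0 c0 c Hc)). intros z Hz.
  symmetry. now apply annulus_period_function.
- apply (is_derive_comp (V := R_NormedModule) (polar_period f) (fun z => sqrt (2 * z))).
  + exact (polar_period_is_derive annulus_polar Hr).
  + auto_derive; [lra | field; lra].
Qed.

(** Taking [s] to be 1 or -1 covers the increasing and the decreasing case at once. *)
Lemma annulus_period_monotone (s k c : R) :
  (forall x, between lo hi x -> x <> 0 ->
     0 < s * (g x ^ 2 - k * g x ^ 3 - 2 * potential g x * Derive g x)) ->
  0 < c < c0 ->
  ex_derive (period_function g lo hi) c /\ 0 < s * Derive (period_function g lo hi) c.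
Proof.
intros H Hc. assert (D := annulus_period_derive Hc).
split; [eexists; exact D |]. rewrite (is_derive_unique _ _ _ D).
destruct (annulus_radius Hc) as [Hr _].
assert (Q := @polar_period_derive_sign g lo hi phi f f' r0 annulus_polar _ k s Hr).
set (I := RInt _ _ _) in *.
assert (Hs : forall u, - r0 < u < r0 -> u <> 0 -> 0 < s * ((f' u - k) * u)).
{ intros u Hu Hu0. destruct (W2 Hu) as [Q1 [Q2 [_ [Q4 [_ [_ [Q7 Q8]]]]]]].
  assert (Hb := annulus_between Q1).
  assert (Hx0 : phi u <> 0).
  { intros E. apply Hu0. rewrite <- Q2, E. unfold amplitude. ring. }
  specialize (H (phi u) Hb Hx0). rewrite (Q8 Hu0). unfold inv_amplitude_derive2, P.
  rewrite Derive_potential, Derive2_potential by exact Hb.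
  set (N := g (phi u) ^ 2 - _ - _) in H.
  assert (Hg : g (phi u) <> 0) by (intros E; rewrite E in Q7; lra).
  (* From [u = g f] and [f' = (g^2 - 2 G g') / g^3] follows [(f' - k) u = N f / g^2], so the sign is
     that of [N]. *)
  replace (s * (_ * u)) with (s * N * (f u / g (phi u) ^ 2)).
  - apply Rmult_lt_0_compat; [exact H |]. apply Rdiv_lt_0_compat; [exact Q4 |].
    now apply pow2_gt_0.
  - unfold N. clear N H Q. set (p := g (phi u)) in *. set (w := f u) in *.
    set (G := potential g (phi u)). set (d := Derive g (phi u)).
    rewrite <- Q7. field. exact Hg. }
specialize (Q Hs).
replace (s * (/ sqrt (2 * c) * I)) with (/ sqrt (2 * c) * (s * I)) by ring.
apply Rmult_lt_0_compat; [now apply Rinv_0_lt_compat | exact Q].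
Qed.

(** [f] is affine, and its linear part integrates to zero over a turn. The value of [f'] at 0 is not
    among the data; 0 is an end of every interval on which [f] is recovered from [f']. *)
Lemma annulus_constant_period (alpha r : R) :
  (forall u, - r0 < u < r0 -> u <> 0 -> f' u = alpha) -> 0 < r < r0 ->
  polar_period f r = 2 * PI * f 0.
Proof.
intros H Hr.
assert (Af : forall u, - r0 < u < r0 -> f u = f 0 + alpha * u).
{ intros u Hu.
  assert (D : forall t, - r0 < t < r0 -> is_derive (fun z => f z - alpha * z) t (f' t - alpha)).
  { intros t Ht. apply (is_derive_minus (V := R_NormedModule) f (fun z => alpha * z)).
    - now apply annulus_polar.
    - auto_derive; [easy | ring]. }
  assert (Hull : forall t, Rmin 0 u <= t <= Rmax 0 u -> - r0 < t < r0).
  { intros t. unfold Rmin, Rmax. destruct (Rle_dec 0 u); lra. }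
  assert (E := @zero_derive_const (fun z => f z - alpha * z) 0 u).
  simpl in E. rewrite Rmult_0_r, Rminus_0_r in E. rewrite E.
  - ring.
  - intros t Ht. apply is_derive_eq with (f' t - alpha); [apply D, Hull; lra |].
    rewrite H; [ring | apply Hull; lra |].
    revert Ht. unfold Rmin, Rmax. destruct (Rle_dec 0 u); lra.
  - intros t Ht. exact (is_derive_cont (D t (Hull t Ht))). }
apply is_RInt_unique.
apply (is_RInt_ext (fun th => f 0 + alpha * (r * sin th))).
{ intros th _. symmetry. apply Af. now apply polar_range. }
replace (2 * PI * f 0) with (minus (f 0 * (2 * PI) - alpha * r * cos (2 * PI))
  (f 0 * 0 - alpha * r * cos 0))
  by (rewrite cos_2PI, cos_0; unfold minus, plus, opp; simpl; ring).
apply (is_RInt_derive (V := R_CompleteNormedModule) (fun th => f 0 * th - alpha * r * cos th)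
  (fun th => f 0 + alpha * (r * sin th))).
- intros z _. auto_derive; [easy | ring].
- intros z _. apply ex_derive_cont. auto_derive. easy.
Qed.

Lemma annulus_derive2_const (alpha u : R) :
  (forall x, between lo hi x -> x <> 0 ->
     is_derive (fun z => potential g z / g z ^ 2) x alpha) ->
  - r0 < u < r0 -> u <> 0 -> f' u = alpha.
Proof.
intros H Hu Hu0. destruct (W2 Hu) as [Q1 [Q2 [_ [Q4 [_ [_ [Q7 Q8]]]]]]].
assert (Hb := annulus_between Q1).
assert (Hx0 : phi u <> 0).
{ intros E. apply Hu0. rewrite <- Q2, E. unfold amplitude. ring. }
assert (Hg : g (phi u) <> 0) by (intros E; rewrite E in Q7; lra).
rewrite (Q8 Hu0). unfold inv_amplitude_derive2, P. rewrite Derive_potential, Derive2_potential by exact Hb.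
rewrite <- (is_derive_unique _ _ _ (H _ Hb Hx0)). symmetry. apply is_derive_unique.
apply is_derive_eq with
  ((g (phi u) * g (phi u) ^ 2 - potential g (phi u) * (2 * Derive g (phi u) * g (phi u) ^ 1))
   / (g (phi u) ^ 2) ^ 2).
- apply is_derive_div.
  + now apply potential_is_derive.
  + apply (is_derive_pow g 2). now apply C1_at_is_derive, field_C1.
  + now apply pow_nonzero.
- field. exact Hg.
Qed.

Lemma annulus_near_origin : 0 < c0 ->
  exists eps, 0 < eps /\ forall x y, 0 < x ^ 2 + y ^ 2 < eps ^ 2 ->
    a0 < x < b0 /\ 0 < y ^ 2 / 2 + P x < c0.
Proof.
intros Hc. pose proof tp0 as [H1 [H2 [H3 [H4 [H5 _]]]]].
assert (L : locally 0 (fun x => between a0 b0 x /\ P x < c0 / 2)).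
{ apply filter_and; [now apply between_locally |].
  assert (C : continuous (potential g) 0) by exact (is_derive_cont (potential_is_derive h0)).
  apply (C (fun z => z < c0 / 2)). apply open_lt. rewrite potential_0. lra. }
destruct (locally_ball L) as [d [Hd Q]].
(* For [e] at most 1 and at most [c0], [e^2 <= c0]; hence [y^2 / 2 < c0 / 2], and [d] leaves the
   other half of [c0] to the potential. *)
exists (Rmin d (Rmin 1 c0)).
assert (M : 0 < Rmin d (Rmin 1 c0)) by (repeat apply Rmin_pos; lra).
split; [exact M |]. intros x y Hxy.
assert (M1 : Rmin d (Rmin 1 c0) <= d) by apply Rmin_l.
assert (M2 : Rmin d (Rmin 1 c0) <= Rmin 1 c0) by apply Rmin_r.
assert (M3 : Rmin 1 c0 <= 1) by apply Rmin_l.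
assert (M4 : Rmin 1 c0 <= c0) by apply Rmin_r.
set (e := Rmin d (Rmin 1 c0)) in *.
assert (Hx : Rabs (x - 0) < d) by (rewrite Rminus_0_r; apply Rabs_def1; nra).
destruct (Q x Hx) as [B K]. split; [exact B |].
assert (y ^ 2 < c0) by nra. split; [| lra].
destruct (Req_dec x 0) as [-> | Hx0].
- unfold P. rewrite potential_0. nra.
- assert (0 < P x).
  { apply (well_potential_pos potential_normal H1 H2 H3 annulus_pos); [| exact Hx0].
    destruct B as [B1 B2]. simpl in B1, B2. lra. }
  nra.
Qed.

End Annulus.

(** * The Urabe potential *)

(* the binomial coefficients [1/2 choose n] *)
Fixpoint sqrt_coef (n : nat) : R :=
  match n with
  | O => 1
  | S m => sqrt_coef m * ((1 / 2 - INR m) / INR (S m))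
  end.

(** The ratios [|1/2 - n| / (n + 1)] of consecutive coefficients are at most 1. The crude bound
    already yields a radius of convergence at least 1. *)
Lemma sqrt_coef_bound (n : nat) : Rabs (sqrt_coef n) <= 1.
Proof.
induction n as [| n IH].
- simpl. rewrite Rabs_R1. lra.
- change (sqrt_coef (S n)) with (sqrt_coef n * ((1 / 2 - INR n) / INR (S n))).
  rewrite Rabs_mult, S_INR. pose proof (pos_INR n).
  assert (Rabs ((1 / 2 - INR n) / (INR n + 1)) <= 1).
  { rewrite Rabs_div, (Rabs_pos_eq (INR n + 1)) by lra.
    apply Rmult_le_reg_r with (INR n + 1); [lra |].
    unfold Rdiv. rewrite Rmult_assoc, Rinv_l by lra.
    assert (Rabs (1 * / 2 - INR n) <= INR n + 1) by (apply Rabs_le; lra). lra. }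
  pose proof (Rabs_pos (sqrt_coef n)).
  pose proof (Rabs_pos ((1 / 2 - INR n) / (INR n + 1))). nra.
Qed.

Lemma CV_radius_ge (a : nat -> R) (r M : R) :
  (forall n, Rabs (a n * r ^ n) <= M) -> Rbar_le r (CV_radius a).
Proof. intros H. apply (CV_radius_bounded a). now exists M. Qed.

Lemma sqrt_coef_radius (x : R) : Rabs x < 1 -> Rbar_lt (Rabs x) (CV_radius sqrt_coef).
Proof.
intros Hx. apply Rbar_lt_le_trans with 1; [exact Hx |].
apply CV_radius_ge with 1. intros n. rewrite pow1, Rmult_1_r. apply sqrt_coef_bound.
Qed.

Lemma sqrt_series_ode (x : R) : Rabs x < 1 ->
  (1 + x) * PSeries (PS_derive sqrt_coef) x = PSeries sqrt_coef x / 2.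
Proof.
intros Hx. assert (Hr := sqrt_coef_radius Hx).
assert (Ed : ex_pseries (PS_derive sqrt_coef) x).
{ apply CV_radius_inside. now rewrite CV_radius_derive. }
rewrite Rmult_plus_distr_r, Rmult_1_l, <- PSeries_incr_1.
rewrite <- PSeries_plus; [| exact Ed | now apply ex_pseries_incr_1].
replace (PSeries sqrt_coef x / 2) with (1 / 2 * PSeries sqrt_coef x) by field.
rewrite <- PSeries_scal. apply PSeries_ext. intros n.
unfold PS_plus, PS_scal, PS_incr_1, PS_derive.
destruct n as [| n].
- simpl. unfold plus, scal, zero; simpl. unfold mult; simpl. field.
- change (sqrt_coef (S (S n))) with (sqrt_coef (S n) * ((1 / 2 - INR (S n)) / INR (S (S n)))).
  change (sqrt_coef (S n)) with (sqrt_coef n * ((1 / 2 - INR n) / INR (S n))).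
  rewrite !S_INR. pose proof (pos_INR n).
  unfold plus, scal; simpl; unfold mult; simpl. field. split; lra.
Qed.

(** Both sides solve [(1 + x) s' = s / 2] with [s 0 = 1], so their quotient has zero derivative. *)
Lemma sqrt_series (x : R) : Rabs x < 1 -> PSeries sqrt_coef x = sqrt (1 + x).
Proof.
intros Hx.
assert (Hull : forall t, Rmin 0 x <= t <= Rmax 0 x -> Rabs t < 1).
{ intros t Ht. apply Rabs_def2 in Hx. revert Ht.
  unfold Rmin, Rmax. destruct (Rle_dec 0 x); intros; apply Rabs_def1; lra. }
assert (D : forall t, Rmin 0 x <= t <= Rmax 0 x ->
  is_derive (fun z => PSeries sqrt_coef z / sqrt (1 + z)) t 0).
{ intros t Ht. specialize (Hull t Ht). assert (Hb := Rabs_def2 _ _ Hull).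
  assert (Hs : 0 < sqrt (1 + t)) by (apply sqrt_lt_R0; lra).
  assert (S2 : sqrt (1 + t) * sqrt (1 + t) = 1 + t) by (apply sqrt_sqrt; lra).
  apply is_derive_eq with
    ((PSeries (PS_derive sqrt_coef) t * sqrt (1 + t)
      - PSeries sqrt_coef t * (1 / (2 * sqrt (1 + t)))) / sqrt (1 + t) ^ 2).
  - apply (is_derive_div (PSeries sqrt_coef) (fun z => sqrt (1 + z)));
      [now apply is_derive_PSeries, sqrt_coef_radius | | lra].
    auto_derive; [lra | field; lra].
  - assert (E := sqrt_series_ode Hull). rewrite <- S2 in E.
    assert (E' : PSeries sqrt_coef t
      = 2 * (sqrt (1 + t) * sqrt (1 + t)) * PSeries (PS_derive sqrt_coef) t) by lra.
    rewrite E'. field. lra. }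
assert (E := @zero_derive_const (fun z => PSeries sqrt_coef z / sqrt (1 + z)) 0 x
  (fun t Ht => D t ltac:(lra)) (fun t Ht => is_derive_cont (D t Ht))).
simpl in E. rewrite PSeries_0, Rplus_0_r, sqrt_1 in E. simpl in E.
apply Rabs_def2 in Hx. assert (0 < sqrt (1 + x)) by (apply sqrt_lt_R0; lra).
replace (PSeries sqrt_coef x)
  with (PSeries sqrt_coef x / sqrt (1 + x) * sqrt (1 + x)) by (field; lra).
rewrite <- E. field.
Qed.

Lemma analytic_at_sqrt_affine (p q nu k x0 : R) :
  analytic_at (fun x => p + q * (x - x0) + nu * sqrt (1 + k * (x - x0))) x0.
Proof.
set (c := fun n => nu * (sqrt_coef n * k ^ n)).
set (a := fun n => match n with O => p + c O | 1%nat => q + c 1%nat | _ => c n end).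
assert (Pk := Rabs_pos k).
(* Chosen so that [r <= 1] and [|k| r <= 1], including when [k = 0]. *)
set (r := / (1 + Rabs k)).
assert (Hr : 0 < r) by (apply Rinv_0_lt_compat; lra).
assert (Hr1 : r <= 1).
{ unfold r. rewrite <- Rinv_1. apply Rinv_le_contravar; lra. }
assert (Hkr : Rabs (k * r) <= 1).
{ rewrite Rabs_mult, (Rabs_pos_eq r) by lra. unfold r.
  apply Rmult_le_reg_r with (1 + Rabs k); [lra |].
  rewrite Rmult_assoc, Rinv_l by lra. lra. }
assert (Bc : forall n, Rabs (c n * r ^ n) <= Rabs nu).
{ intros n. unfold c.
  replace (nu * (sqrt_coef n * k ^ n) * r ^ n) with (nu * (sqrt_coef n * (k * r) ^ n))
    by (rewrite Rpow_mult_distr; ring).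
  rewrite !Rabs_mult, <- RPow_abs. rewrite <- (Rmult_1_r (Rabs nu)) at 2.
  apply Rmult_le_compat_l; [apply Rabs_pos |]. rewrite <- (Rmult_1_r 1).
  apply Rmult_le_compat; [apply Rabs_pos | apply pow_le, Rabs_pos | apply sqrt_coef_bound |].
  rewrite <- (pow1 n). apply pow_incr. split; [apply Rabs_pos | exact Hkr]. }
assert (Ba : forall n, Rabs (a n * r ^ n) <= Rabs p + Rabs q + Rabs nu).
{ pose proof (Rabs_pos p). pose proof (Rabs_pos q). intros [| [| n]].
  - change (a 0%nat * r ^ 0) with ((p + c 0%nat) * r ^ 0).
    rewrite Rmult_plus_distr_r. apply Rle_trans with (1 := Rabs_triang _ _).
    specialize (Bc 0%nat). simpl pow at 1. rewrite Rmult_1_r. lra.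
  - change (a 1%nat * r ^ 1) with ((q + c 1%nat) * r ^ 1).
    rewrite Rmult_plus_distr_r. apply Rle_trans with (1 := Rabs_triang _ _).
    specialize (Bc 1%nat).
    assert (Rabs (q * r ^ 1) <= Rabs q).
    { rewrite pow_1, Rabs_mult, (Rabs_pos_eq r) by lra. nra. }
    lra.
  - specialize (Bc (S (S n))). change (a (S (S n))) with (c (S (S n))). lra. }
assert (Ra : Rbar_le r (CV_radius a)) by (exact (CV_radius_ge Ba)).
assert (Rc : Rbar_le r (CV_radius c)) by (exact (CV_radius_ge Bc)).
exists a. split; [apply Rbar_lt_le_trans with r; [exact Hr | exact Ra] |].
apply (@ball_locally x0 r); [exact Hr |]. intros x Hx. set (z := x - x0) in *.
assert (Ia : Rbar_lt (Rabs z) (CV_radius a)) by (apply Rbar_lt_le_trans with r; [exact Hx | exact Ra]).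
assert (Ic : Rbar_lt (Rabs z) (CV_radius c)) by (apply Rbar_lt_le_trans with r; [exact Hx | exact Rc]).
(* The coefficients [a] and [c] agree from index 2 on; peeling off two terms leaves the same tail,
   and the first two terms carry the affine part. *)
assert (Step : forall b : nat -> R, Rbar_lt (Rabs z) (CV_radius b) ->
  PSeries b z = b 0%nat + z * (b 1%nat + z * PSeries (PS_decr_1 (PS_decr_1 b)) z)).
{ intros b Hb. rewrite PSeries_decr_1 by now apply CV_radius_inside.
  rewrite (PSeries_decr_1 (PS_decr_1 b)); [reflexivity |].
  apply CV_radius_inside. now rewrite CV_radius_decr_1. }
assert (Sc : PSeries c z = nu * sqrt (1 + k * z)).
{ rewrite <- sqrt_series.
  - unfold PSeries, c. rewrite <- Series_scal_l. apply Series_ext. intros n.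
    rewrite Rpow_mult_distr. ring.
  - destruct (Req_dec k 0) as [-> | Hk]; [rewrite Rmult_0_l, Rabs_R0; lra |].
    apply Rlt_le_trans with (2 := Hkr). rewrite !Rabs_mult, (Rabs_pos_eq r) by lra.
    apply Rmult_lt_compat_l; [now apply Rabs_pos_lt | exact Hx]. }
rewrite <- Sc, (Step a Ia), (Step c Ic).
change (PSeries (PS_decr_1 (PS_decr_1 a)) z) with (PSeries (PS_decr_1 (PS_decr_1 c)) z).
simpl. ring.
Qed.

Lemma Rabs_lt_inv (beta x : R) :
  beta <> 0 -> Rabs x < 1 / Rabs beta -> Rabs (beta * x) < 1.
Proof.
intros Hb Hx. assert (P := Rabs_pos_lt _ Hb). rewrite Rabs_mult.
apply Rmult_lt_compat_l with (r := Rabs beta) in Hx; [| exact P].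
replace (Rabs beta * (1 / Rabs beta)) with 1 in Hx by (field; lra). exact Hx.
Qed.

Section Urabe.

Variable beta : R.
Hypothesis Hbeta : beta <> 0.

(** Recentring at [x0]: [1 - beta x = m (1 - (beta / m) (x - x0))] with [m = 1 - beta x0], so the
    function is affine plus a square root of the form already expanded. *)
Lemma urabe_analytic (x0 : R) : 0 < 1 - beta * x0 -> analytic_at (urabe beta) x0.
Proof.
intros Hx. set (m := 1 - beta * x0) in *.
apply analytic_at_ext_loc with (fun x =>
  (4 / beta ^ 2 - 2 / beta * x0) + (- (2 / beta)) * (x - x0)
  + (- (4 / beta ^ 2) * sqrt m) * sqrt (1 + (- (beta / m)) * (x - x0)));
  [| apply analytic_at_sqrt_affine].
apply filter_forall. intros x. unfold urabe.
replace (1 - beta * x) with (m * (1 + - (beta / m) * (x - x0))) by (unfold m; field; unfold m in Hx; lra).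
rewrite sqrt_mult_alt by lra. refine (_ : @eq R _ _). field. exact Hbeta.
Qed.

Lemma urabe_is_derive (x : R) : 0 < 1 - beta * x ->
  is_derive (urabe beta) x (2 / beta * (/ sqrt (1 - beta * x) - 1)).
Proof.
intros Hx. assert (0 < sqrt (1 - beta * x)) by (apply sqrt_lt_R0; lra).
unfold urabe. auto_derive; [lra |]. fold (1 - beta * x). field. split; [lra | exact Hbeta].
Qed.

Lemma urabe_domain (x : R) : between (- (1 / Rabs beta)) (1 / Rabs beta) x -> 0 < 1 - beta * x.
Proof.
intros [H1 H2]. simpl in H1, H2.
assert (H := Rabs_lt_inv Hbeta (Rabs_def1 _ _ H2 H1)). apply Rabs_def2 in H. lra.
Qed.

(** With [s = sqrt (1 - beta x)] everything is rational: the potential is [2 (1 - s)^2 / beta^2],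
    its derivative [2 (1 - s) / (beta s)], and the ratio [s^2 / 2]. Here [x <> 0] gives [s <> 1]. *)
Lemma urabe_ratio (x : R) : 0 < 1 - beta * x -> x <> 0 ->
  urabe beta x / Derive (urabe beta) x ^ 2 = (1 - beta * x) / 2.
Proof.
intros Hx Hx0. rewrite (is_derive_unique _ _ _ (urabe_is_derive Hx)). unfold urabe.
assert (Hs : 0 < sqrt (1 - beta * x)) by (apply sqrt_lt_R0; lra).
assert (S2 : sqrt (1 - beta * x) * sqrt (1 - beta * x) = 1 - beta * x) by (apply sqrt_sqrt; lra).
set (s := sqrt (1 - beta * x)) in *.
assert (Hs1 : s <> 1).
{ intros E. rewrite E in S2. apply Hx0. apply Rmult_eq_reg_l with beta; lra. }
assert (Ex : x = (1 - s * s) / beta) by (rewrite S2; field; exact Hbeta).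
rewrite Ex. field. repeat split; try lra; exact Hbeta.
Qed.

Lemma urabe_normalized (alpha : R) : beta = - 2 * alpha ->
  normalized_solution alpha (urabe beta) (- (1 / Rabs beta)) (1 / Rabs beta).
Proof.
intros Hab. assert (D0 : 0 < 1 - beta * 0) by lra.
assert (S0 : sqrt (1 - beta * 0) = 1) by (rewrite Rmult_0_r, Rminus_0_r; exact sqrt_1).
split; [| split; [| split; [| split]]].
- intros x Hx. now apply urabe_analytic, urabe_domain.
- unfold urabe. rewrite S0. field. exact Hbeta.
- rewrite (is_derive_unique _ _ _ (urabe_is_derive D0)), S0. field. exact Hbeta.
- change (Derive (Derive (urabe beta)) 0 = 1). apply is_derive_unique.
  apply is_derive_ext_loc with (fun x => 2 / beta * (/ sqrt (1 - beta * x) - 1)).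
  + apply (@ball_locally 0 (1 / Rabs beta)).
    * apply Rdiv_lt_0_compat; [lra | now apply Rabs_pos_lt].
    * intros x Hx. rewrite Rminus_0_r in Hx. symmetry.
      apply is_derive_unique, urabe_is_derive, urabe_domain.
      apply Rabs_def2 in Hx. now split.
  + auto_derive; fold (1 - beta * 0); rewrite S0; [lra |]. field. exact Hbeta.
- intros x Hx Hx0. apply is_derive_ext_loc with (fun z => (1 - beta * z) / 2).
  + refine (filter_imp _ _ _ (filter_and _ _ (between_locally Hx) (locally_neq Hx0))).
    intros z [Hz Hz0]. symmetry. now apply urabe_ratio; [apply urabe_domain |].
  + auto_derive; [easy |]. rewrite Hab. field.
Qed.

End Urabe.

(** * Uniqueness of the Urabe potential *)

Section UrabeUnique.

Variables (alpha : R) (P : R -> R) (lo hi : Rbar).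
Hypothesis Halpha : alpha <> 0.
Hypothesis h0 : between lo hi 0.
Hypothesis HP : normal_potential P lo hi.
Hypothesis Heq : potential_equation alpha P lo hi.

Let A := divx (Derive P).
Let B := divx (divx P).

Lemma between_segment (x t : R) :
  between lo hi x -> Rmin 0 x <= t <= Rmax 0 x -> between lo hi t.
Proof.
intros Hx. unfold Rmin, Rmax. destruct (Rle_dec 0 x); intros Ht.
- exact (between_convex h0 Hx Ht).
- exact (between_convex Hx h0 Ht).
Qed.

Lemma ratio_factor (z : R) : z <> 0 -> P z / Derive P z ^ 2 = B z / A z ^ 2.
Proof.
intros Hz. rewrite <- (normal_factor2 HP z), <- (normal_factor1 HP z). fold A B.
rewrite Rpow_mult_distr. unfold Rdiv. rewrite Rinv_mult.
(* The inverse stays opaque because [A z] is not yet known to be nonzero; only powers of [z] are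
   cancelled. *)
set (i := / A z ^ 2). field. exact Hz.
Qed.

(** The equation is silent at 0, where [P / P'^2] is 0 / 0. The quotient [B / A^2] continues it
    there with value 1/2, and the equation then integrates from 0 to either side. *)
Lemma potential_ratio (x : R) : between lo hi x -> B x / A x ^ 2 = 1 / 2 + alpha * x.
Proof.
intros Hx.
assert (D : forall t, between lo hi t -> t <> 0 -> is_derive (fun z => B z / A z ^ 2 - alpha * z) t 0).
{ intros t Ht Ht0. apply is_derive_ext_loc with (fun z => P z / Derive P z ^ 2 - alpha * z).
  - refine (filter_imp _ _ _ (locally_neq Ht0)). intros z Hz. now rewrite ratio_factor.
  - apply is_derive_eq with (alpha - alpha); [| ring].
    apply (is_derive_minus (V := R_NormedModule) (fun z => P z / Derive P z ^ 2) (fun z => alpha * z)).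
    + now apply Heq.
    + auto_derive; [easy | ring]. }
assert (A0 : A 0 = 1) by exact (normal_factor1_0 HP).
assert (B0 : B 0 = 1 / 2) by exact (normal_factor2_0 h0 HP).
assert (E := @zero_derive_const (fun z => B z / A z ^ 2 - alpha * z) 0 x).
simpl in E. rewrite A0, B0 in E.
enough (1 / 2 / (1 * (1 * 1)) - alpha * 0 = B x / A x ^ 2 - alpha * x) by (simpl in *; lra).
apply E.
- intros t Ht. apply D; [apply (between_segment Hx); lra |].
  revert Ht. unfold Rmin, Rmax. destruct (Rle_dec 0 x); lra.
- intros t Ht. destruct (Req_dec t 0) as [-> | Ht0].
  + assert (DA := C1_at_is_derive (normal_C1_factor1 h0 HP h0)).
    assert (DB := C1_at_is_derive (normal_C1_factor2 h0 HP h0)). fold A in DA. fold B in DB.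
    apply ex_derive_cont. auto_derive. rewrite A0. assert (EA : ex_derive A 0) by exact (ex_intro _ _ DA).
    assert (EB : ex_derive B 0) by exact (ex_intro _ _ DB).
    repeat match goal with |- _ /\ _ => split end; try easy. lra.
  + exact (is_derive_cont (D t (between_segment Hx Ht) Ht0)).
Qed.

Lemma factor1_neq0 (x : R) : between lo hi x -> 0 < 1 / 2 + alpha * x -> A x <> 0.
Proof.
intros Hx Hp E. pose proof (potential_ratio Hx) as Q. rewrite E in Q.
(* A zero of [A] would make the quotient a division by zero, whose value is 0 by convention, against
   the positive right side. *)
unfold Rdiv in Q. rewrite pow_ne_zero, Rinv_0, Rmult_0_r in Q by discriminate. lra.
Qed.

Lemma segment_pos (x t : R) :
  0 < 1 / 2 + alpha * x -> Rmin 0 x <= t <= Rmax 0 x -> 0 < 1 / 2 + alpha * t.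
Proof.
intros Hx. unfold Rmin, Rmax. destruct (Rle_dec 0 x); intros Ht;
  destruct (Rle_lt_dec 0 alpha); nra.
Qed.

(** [A] is continuous with [A 0 = 1] and has no zero between 0 and [x], so it keeps its sign. *)
Lemma factor1_pos (x : R) : between lo hi x -> 0 < 1 / 2 + alpha * x -> 0 < A x.
Proof.
intros Hx Hp. assert (A0 : A 0 = 1) by exact (normal_factor1_0 HP).
assert (C : forall t, Rmin 0 x <= t <= Rmax 0 x -> continuity_pt A t).
{ intros t Ht. apply continuity_pt_filterlim. apply C1_at_cont.
  apply (normal_C1_factor1 h0 HP). exact (between_segment Hx Ht). }
assert (N : forall t, Rmin 0 x <= t <= Rmax 0 x -> A t <> 0).
{ intros t Ht. apply factor1_neq0; [exact (between_segment Hx Ht) | exact (segment_pos Hp Ht)]. }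
destruct (Rle_lt_dec (A x) 0) as [[L | L] | L]; [| | exact L].
- destruct (Rtotal_order x 0) as [G | [G | G]].
  + rewrite Rmin_right, Rmax_left in C, N by lra.
    destruct (IVT_interv A x 0 C G L) as [z [Hz Ez]]; [lra |]. now destruct (N z Hz).
  + rewrite G, A0 in L. lra.
  + rewrite Rmin_left, Rmax_right in C, N by lra.
    destruct (IVT_interv (fun t => - A t) 0 x) as [z [Hz Ez]]; try lra.
    * intros t Ht. apply continuity_pt_opp. now apply C.
    * destruct (N z Hz). lra.
- destruct (N x); [| exact L]. split; [apply Rmin_r | apply Rmax_r].
Qed.

Lemma urabe_amplitude (x : R) : between lo hi x -> 0 < 1 / 2 + alpha * x ->
  amplitude P x = (sqrt (1 + 2 * alpha * x) - 1) / alpha /\ 0 <= B x.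
Proof.
intros Hx Hp.
assert (EB : forall t, between lo hi t -> 0 < 1 / 2 + alpha * t ->
  B t = (1 / 2 + alpha * t) * A t ^ 2 /\ 0 < A t).
{ intros t Ht Hpt. assert (PA := factor1_pos Ht Hpt). split; [| exact PA].
  rewrite <- (potential_ratio Ht). field. lra. }
assert (D : forall t, Rmin 0 x <= t <= Rmax 0 x ->
  is_derive (fun z => amplitude P z - (sqrt (1 + 2 * alpha * z) - 1) / alpha) t 0).
{ intros t Ht. assert (Bt := between_segment Hx Ht). assert (Pt := segment_pos Hp Ht).
  destruct (EB t Bt Pt) as [E PA].
  assert (PB : 0 < B t) by (rewrite E; apply Rmult_lt_0_compat; [exact Pt | now apply pow_lt]).
  assert (Hs : 0 < sqrt (1 + 2 * alpha * t)) by (apply sqrt_lt_R0; lra).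
  (* Here [A > 0] is what makes [sqrt (A^2)] equal to [A], so that [A] cancels from
     [h' = A / sqrt (2 B)]. *)
  assert (Es : sqrt (2 * B t) = sqrt (1 + 2 * alpha * t) * A t).
  { rewrite E. replace (2 * ((1 / 2 + alpha * t) * A t ^ 2))
      with ((1 + 2 * alpha * t) * A t ^ 2) by field.
    rewrite sqrt_mult_alt, sqrt_pow2 by lra. reflexivity. }
  apply is_derive_eq with (A t / sqrt (2 * B t) - / sqrt (1 + 2 * alpha * t)).
  - apply (is_derive_minus (V := R_NormedModule) (amplitude P)
      (fun z => (sqrt (1 + 2 * alpha * z) - 1) / alpha)).
    + exact (amplitude_is_derive h0 HP Bt PB).
    + auto_derive; [lra | field; lra].
  - rewrite Es. field. lra. }
split.
- assert (E := @zero_derive_const _ 0 x (fun t Ht => D t ltac:(lra))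
    (fun t Ht => is_derive_cont (D t Ht))).
  simpl in E. rewrite Rmult_0_r, Rplus_0_r, sqrt_1 in E.
  unfold amplitude in E at 1. rewrite Rmult_0_l in E.
  replace (0 - (1 - 1) / alpha) with 0 in E by (field; exact Halpha). lra.
- destruct (EB x Hx Hp) as [-> PA]. left. apply Rmult_lt_0_compat; [exact Hp | now apply pow_lt].
Qed.

Lemma urabe_unique (x : R) : between lo hi x -> 0 < 1 / 2 + alpha * x ->
  P x = urabe (- 2 * alpha) x.
Proof.
intros Hx Hp. destruct (urabe_amplitude Hx Hp) as [E PB].
assert (S := amplitude_sqr HP PB). rewrite E in S. unfold urabe.
replace (1 - -2 * alpha * x) with (1 + 2 * alpha * x) by ring.
assert (S2 : sqrt (1 + 2 * alpha * x) ^ 2 = 1 + 2 * alpha * x) by (apply pow2_sqrt; lra).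
set (s := sqrt (1 + 2 * alpha * x)) in *.
assert (Ex : x = (s ^ 2 - 1) / (2 * alpha)) by (rewrite S2; field; exact Halpha).
replace (P x) with (((s - 1) / alpha) ^ 2 / 2) by lra.
rewrite Ex. field. exact Halpha.
Qed.

End UrabeUnique.

(** * Monotonicity and isochronicity *)

Lemma energy_bound_gt (g : R -> R) (lo hi : Rbar) (c : R) :
  Rbar_lt c (energy_bound g lo hi) -> exists c0, hypothesis_H g lo hi c0 /\ c < c0.
Proof.
intros Hc. apply NNPP. intros N.
apply (Rbar_lt_not_le _ _ Hc). apply Lub_Rbar_correct.
intros c0 H. destruct (Rle_lt_dec c0 c) as [L | L]; [exact L |].
destruct N. now exists c0.
Qed.

Lemma period_function_monotone (g : R -> R) (lo hi : Rbar) (s k c : R) :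
  between lo hi 0 -> analytic_on g lo hi -> g 0 = 0 -> Derive g 0 = 1 ->
  (forall x, between lo hi x -> x <> 0 ->
     0 < s * (g x ^ 2 - k * g x ^ 3 - 2 * potential g x * Derive g x)) ->
  0 < c -> Rbar_lt c (energy_bound g lo hi) ->
  ex_derive (period_function g lo hi) c /\ 0 < s * Derive (period_function g lo hi) c.
Proof.
intros h0 hg hg0 hg1 H Hc Hb.
destruct (energy_bound_gt Hb) as [c0 [[a0 [b0 tp]] Hc0]].
destruct (annulus_coordinate h0 hg hg0 hg1 tp) as [phi [f [f' [W1 W2]]]].
exact (annulus_period_monotone h0 hg hg0 hg1 tp W1 W2 H (conj Hc Hc0)).
Qed.

Lemma constant_ratio_isochronous (g : R -> R) (lo hi : Rbar) (alpha : R) :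
  between lo hi 0 -> analytic_on g lo hi -> g 0 = 0 -> Derive g 0 = 1 ->
  (exists c, hypothesis_H g lo hi c) ->
  (forall x, between lo hi x -> x <> 0 ->
     is_derive (fun z => potential g z / g z ^ 2) x alpha) ->
  isochronous_center g lo hi.
Proof.
intros h0 hg hg0 hg1 [c0 [a0 [b0 tp]]] H.
destruct (annulus_coordinate h0 hg hg0 hg1 tp) as [phi [f [f' [W1 W2]]]].
assert (Hc0 : 0 < c0).
{ pose proof tp as [H1 [H2 [H3 [H4 [H5 _]]]]].
  exact (well_energy_pos (potential_normal h0 hg hg0 hg1) H1 H2 H3 H5
    (annulus_pos h0 hg tp)). }
destruct (annulus_near_origin h0 hg hg0 hg1 tp Hc0) as [eps [Heps Near]].
split.
- split; [exact hg0 |]. exists eps. split; [exact Heps |].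
  intros x0 y0 H0. destruct (Near x0 y0 H0) as [Hx He].
  destruct (annulus_solution h0 hg hg0 hg1 tp W1 W2 Hx He) as [x [y [S [X0 [Y0 [M _]]]]]].
  eexists x, y, _. split; [exact S |]. split; [exact X0 |]. split; [exact Y0 | exact M].
- exists eps, (2 * PI * f 0). split; [exact Heps |].
  intros x y T S Hxy M.
  (* A solution starting at the equilibrium is constant by uniqueness; half of any of its periods is
     again a period, so a minimal one cannot exist. *)
  destruct (Rle_lt_dec (x 0 ^ 2 + y 0 ^ 2) 0) as [L | L].
  + exfalso.
    assert (Z : is_solution g lo hi (fun _ => 0) (fun _ => 0)).
    { intros t. split; [exact h0 |]. rewrite hg0, Ropp_0.
      split; apply (is_derive_const (V := R_NormedModule)). }
    assert (x 0 = 0) by nra. assert (y 0 = 0) by nra.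
    assert (E := @solution_unique g lo hi x y (fun _ => 0) (fun _ => 0) (field_C1 hg) S Z ltac:(assumption) ltac:(assumption)).
    destruct M as [[HT _] Min].
    assert (Half : is_period x y (T / 2)).
    { split; [lra |]. intros t. now rewrite !(proj1 (E _)), !(proj2 (E _)). }
    apply Min in Half. lra.
  + destruct (Near (x 0) (y 0) (conj L Hxy)) as [Hx He].
    rewrite (annulus_solution_period h0 hg hg0 hg1 tp W1 W2 S Hx He M).
    apply (annulus_constant_period tp W2 (alpha := alpha)).
    * intros u Hu Hu0. exact (annulus_derive2_const h0 hg tp W2 H Hu Hu0).
    * now apply annulus_radius.
Qed.

Lemma normalized_solution_normal (alpha : R) (P : R -> R) (lo hi : Rbar) :
  normalized_solution alpha P lo hi -> normal_potential P lo hi.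
Proof. intros [H1 [H2 [H3 [H4 _]]]]. now repeat split. Qed.

Unset Implicit Arguments.

Theorem mainTheorem5 (g : R -> R) (abar bbar : Rbar)
  (h0 : between abar bbar 0)
  (hg : analytic_on g abar bbar)
  (hg0 : g 0 = 0) (hg1 : Derive g 0 = 1) (hg2 : Derive_n g 2 0 <> 0)
  (hH : exists c, hypothesis_H g abar bbar c) :
  ((forall x, between abar bbar x -> x <> 0 ->
      g x ^ 2 + Derive_n g 2 0 / 3 * g x ^ 3 - 2 * potential g x * Derive g x > 0) ->
   forall c, 0 < c -> Rbar_lt c (energy_bound g abar bbar) ->
     ex_derive (period_function g abar bbar) c /\
     Derive (period_function g abar bbar) c > 0)
  /\
  ((forall x, between abar bbar x -> x <> 0 ->
      g x ^ 2 + Derive_n g 2 0 / 3 * g x ^ 3 - 2 * potential g x * Derive g x < 0) ->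
   forall c, 0 < c -> Rbar_lt c (energy_bound g abar bbar) ->
     ex_derive (period_function g abar bbar) c /\
     Derive (period_function g abar bbar) c < 0)
  /\
  (forall alpha, alpha = - (Derive_n g 2 0 / 3) -> alpha <> 0 ->
   (forall x, between abar bbar x -> x <> 0 ->
      is_derive (fun z => potential g z / g z ^ 2) x alpha) ->
   isochronous_center g abar bbar)
  /\
  (forall alpha beta, alpha <> 0 -> beta = - 2 * alpha ->
     normalized_solution alpha (urabe beta) (- (1 / Rabs beta)) (1 / Rabs beta) /\
     forall (lo hi : Rbar) (P : R -> R),
       between lo hi 0 -> normalized_solution alpha P lo hi ->
       forall x, between lo hi x -> Rabs x < 1 / Rabs beta -> P x = urabe beta x).
Proof.
split; [| split; [| split]].
- intros H c Hc Hb.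
  destruct (@period_function_monotone g abar bbar 1 (- (Derive_n g 2 0 / 3)) c h0 hg hg0 hg1)
    as [D1 D2]; [| exact Hc | exact Hb |].
  + intros x Hx Hx0. specialize (H x Hx Hx0). lra.
  + split; [exact D1 | lra].
- intros H c Hc Hb.
  destruct (@period_function_monotone g abar bbar (-1) (- (Derive_n g 2 0 / 3)) c h0 hg hg0 hg1)
    as [D1 D2]; [| exact Hc | exact Hb |].
  + intros x Hx Hx0. specialize (H x Hx Hx0). lra.
  + split; [exact D1 | lra].
- intros alpha _ _ H. exact (constant_ratio_isochronous h0 hg hg0 hg1 hH H).
- intros alpha beta Ha Hab. assert (Hb : beta <> 0) by lra.
  split; [now apply urabe_normalized |].
  intros lo hi P Hlh HN x Hx Hxb. rewrite Hab.
  pose proof HN as [_ [_ [_ [_ Heq]]]].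
  apply (urabe_unique Ha Hlh (normalized_solution_normal HN) Heq Hx).
  assert (Q := Rabs_lt_inv Hb Hxb). apply Rabs_def2 in Q. rewrite Hab in Q. lra.
Qed.
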